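(* Let $\alpha\in F\setminus\{0\}$. The trace $T$-ideal $\mathrm{Id}^{tr}\big(D_3^{t_{\alpha,\alpha,0}}\big)$ is generated, as a $T^{tr}$-ideal, by the polynomials $f_1=[x_1,x_2]$ and $$g_3=\mathrm{Tr}(x_1)\mathrm{Tr}(x_2)\mathrm{Tr}(x_3)+2\alpha^2\mathrm{Tr}(x_1x_2x_3)-\alpha\mathrm{Tr}(x_1)\mathrm{Tr}(x_2x_3)-\alpha\mathrm{Tr}(x_2)\mathrm{Tr}(x_1x_3)-\alpha\mathrm{Tr}(x_1x_2)\mathrm{Tr}(x_3).$$ Moreover, for every $n\ge 1$, $$c_n^{tr}\big(D_3^{t_{\alpha,\alpha,0}}\big)=\sum_{k=0}^n\binom nk+\sum_{t=2}^n\binom nt S(t,2)=\frac{3^n+1}{2}.$$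
   Context: $F$ is a field of characteristic zero; all algebras are associative, unitary, over $F$. An algebra with trace is an algebra $A$ with a linear map $\mathrm{tr}\colon A\to F$ such that $\mathrm{tr}(ab)=\mathrm{tr}(ba)$ for all $a,b\in A$; $F$ is identified with $F\cdot 1_A\subseteq A$. Let $X=\{x_1,x_2,\dots\}$ and let $\mathcal M$ be the set of (nonempty) monomials in the noncommuting variables of $X$. The free algebra with trace is $F\langle X,\mathrm{Tr}\rangle\cong F\langle X\rangle\otimes F[\mathrm{Tr}(M)\mid M\in\mathcal M]$, where the $\mathrm{Tr}(M)$ are central commuting variables subject to $\mathrm{Tr}(MN)=\mathrm{Tr}(NM)$ and $\mathrm{Tr}(\mathrm{Tr}(M)N)=\mathrm{Tr}(M)\mathrm{Tr}(N)$. Its elements are called trace polynomials; the symbol $\mathrm{Tr}(1)$ does not occur. A trace polynomial is pure if all its variables appear inside traces. A trace polynomial $f(x_1,\dots,x_n,\mathrm{Tr})$ is a trace identity of $A$ if it vanishes whenever the $x_i$ are replaced by arbitrary elements of $A$ and $\mathrm{Tr}$ by $\mathrm{tr}$. $\mathrm{Id}^{tr}(A)$ is the set of all trace identities of $A$. A $T^{tr}$-ideal (trace $T$-ideal) is an ideal of $F\langle X,\mathrm{Tr}\rangle$ invariant under all endomorphisms (substitutions of the variables by linear combinations, with coefficients in $F[\mathrm{Tr}(M)\mid M\in\mathcal M]$, of nonempty monomials, compatibly with $\mathrm{Tr}$) and closed under taking traces ($f\mapsto \mathrm{Tr}(fM)$ for $M\in\mathcal M$, and $f\mapsto\mathrm{Tr}(f)$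 when $f$ has no pure trace term). The $T^{tr}$-ideal generated by a set is the smallest one containing it. $[x_1,x_2]=x_1x_2-x_2x_1$. $MT_n$ is the space of multilinear trace polynomials in $x_1,\dots,x_n$, spanned by the elements $\mathrm{Tr}(x_{i_1}\cdots x_{i_a})\cdots\mathrm{Tr}(x_{j_1}\cdots x_{j_b})x_{l_1}\cdots x_{l_c}$ in which each of $x_1,\dots,x_n$ occurs exactly once. The $n$-th trace codimension is $c_n^{tr}(A)=\dim_F MT_n/(MT_n\cap\mathrm{Id}^{tr}(A))$. $D_3$ is the algebra of $3\times3$ diagonal matrices over $F$, and $D_3^{t_{\alpha,\alpha,0}}$ is $D_3$ with trace $t_{\alpha,\alpha,0}(\mathrm{diag}(a_{11},a_{22},a_{33}))=\alpha a_{11}+\alpha a_{22}$. $S(n,k)$ is the Stirling number of the second kind: the number of partitions of a set of $n$ objects into $k$ nonempty subsets. *)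

(* Defs.v *)
From HB Require Import structures.
From mathcomp Require Import all_boot all_order all_algebra generic_quotient.
From mathcomp Require Import finmap.
From mathcomp Require Export monalg.

Set Implicit Arguments.
Unset Strict Implicit.
Unset Printing Implicit Defensive.

Import GRing.Theory.
Local Open Scope ring_scope.
Local Open Scope quotient_scope.

(* Monomials are words in the letters 0, 1, 2, ...; the letter i stands for the
   variable x_{i+1}. *)
Definition nonempty_word := {v : seq nat | v != [::]}.

(* Tr(MN) = Tr(NM) identifies two words exactly when they are rotations of each
   other. *)
Definition cyc_rel : rel nonempty_word :=
  fun v w => [exists i : 'I_(size (val v)).+1, rot i (val v) == val w].

Lemma cyc_relP v w :
  reflect (exists i, rot i (val v) = val w) (cyc_rel v w).
Proof.
apply: (iffP existsP) => [[i /eqP <-]|[i <-]]; first by exists i.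
case: (leqP i (size (val v))) => hi.
  by exists (Ordinal (hi : (i < (size (val v)).+1)%N)).
by exists ord0; rewrite rot0 rot_oversize // ltnW.
Qed.

Lemma cyc_rel_refl : reflexive cyc_rel.
Proof. by move=> v; apply/cyc_relP; exists 0%N; rewrite rot0. Qed.

Lemma cyc_rel_sym : symmetric cyc_rel.
Proof.
suff sub v w : cyc_rel v w -> cyc_rel w v.
  by move=> v w; apply/idP/idP; apply: sub.
case/cyc_relP=> i vw; apply/cyc_relP.
by exists (size (rot i (val v)) - i)%N; rewrite -vw -[LHS]/(rotr _ _) rotK.
Qed.

Lemma cyc_rel_trans : transitive cyc_rel.
Proof.
move=> w v z /existsP[[i /= leiv] /eqP vw] /existsP[[j /= lejw] /eqP wz].
have leiv' : (i <= size (val v))%N by [].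
have lejv : (j <= size (val v))%N by rewrite -(size_rot i) vw.
move: wz; rewrite -vw (rot_add_mod leiv' lejv) => wz.
by apply/cyc_relP; eexists; exact: wz.
Qed.

Canonical cyc_equiv := EquivRel cyc_rel cyc_rel_refl cyc_rel_sym cyc_rel_trans.

(* The indices of the commuting variables Tr(M). *)
Definition cyc_word := {eq_quot cyc_equiv}.
HB.instance Definition _ := Choice.on cyc_word.
HB.instance Definition _ := EqQuotient.on cyc_word.

(* tcoef F is F[Tr(M) | M nonempty]; F<X> (x) F[Tr(M)] is realised as the free
   algebra on X over tcoef F. *)
Definition tcoef (F : fieldType) := {malg F[{cmonom cyc_word}]}.
HB.instance Definition _ (F : fieldType) := GRing.ComAlgebra.on (tcoef F).

Definition tpoly (F : fieldType) := {malg (tcoef F)[{fmonom nat}]}.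
HB.instance Definition _ (F : fieldType) := GRing.Lalgebra.on (tpoly F).

Definition word_prod (A : nzRingType) (u : nat -> A) (v : seq nat) : A :=
  \prod_(i <- v) u i.

Section TracePolynomials.
Variable F : fieldType.
Implicit Types (f g : tpoly F).

Definition tvar (i : nat) : tpoly F := << fmu i >>.
Definition word_mono (v : seq nat) : tpoly F := word_prod tvar v.

Definition fscale (c : F) f : tpoly F := (c%:A : tcoef F) *: f.

(* The value at the empty word is a dummy, as Tr(1) does not exist. *)
Definition tr_word (v : seq nat) : tcoef F :=
  if insub v is Some w then << ucm (\pi_cyc_word w) >> else 0.

(* The formal trace, linear over tcoef F; it is meaningful on the f that
   satisfy no_pure_term. *)
Definition tr_coef f : tcoef F := mmap idfun (fun m : {fmonom nat} => tr_word m) f.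
Definition Tr f : tpoly F := (tr_coef f)%:MP.

Definition no_pure_term f : Prop := f@_(mone : {fmonom nat}) = 0.

End TracePolynomials.

(* The value of a trace polynomial when each x_i is replaced by u i, Tr by t, and
   the base field is mapped to the (central) scalars by iota. *)
Section Evaluation.
Variables (F : fieldType) (K : comNzRingType) (A : lalgType K).
Variables (iota : F -> K) (t : A -> K) (u : nat -> A).

Definition eval_coef : tcoef F -> K :=
  mmap iota (fun k : {cmonom cyc_word} =>
    \prod_(c <- finsupp k) t (word_prod u (val (repr c))) ^+ k c).

Definition eval_tpoly (f : tpoly F) : A :=
  \sum_(m <- msupp f) eval_coef f@_m *: word_prod u m.

End Evaluation.

Record trace_map (F : fieldType) (A : algType F) := TraceMap {
  trace_fun :> {scalar A};
  trace_mulC : forall a b : A, trace_fun (a * b) = trace_fun (b * a)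
}.

Definition trace_identity (F : fieldType) (A : algType F) (t : trace_map A)
    (f : tpoly F) : Prop :=
  forall u : nat -> A, eval_tpoly idfun t u f = 0.

Section TraceIdeals.
Variable F : fieldType.

(* The endomorphism x_i |-> s i, Tr(M) |-> Tr(M(s)). *)
Definition tsubst (s : nat -> tpoly F) : tpoly F -> tpoly F :=
  eval_tpoly (fun c : F => c%:A : tcoef F) (@tr_coef F) s.

Record trace_T_ideal (I : tpoly F -> Prop) : Prop := {
  tideal0 : I 0;
  tidealD : forall f g, I f -> I g -> I (f + g);
  tidealMl : forall f g, I g -> I (f * g);
  tidealMr : forall f g, I f -> I (f * g);
  tideal_subst : forall s, (forall i, no_pure_term (s i)) ->
    forall f, I f -> I (tsubst s f);
  tideal_trM : forall f v, v != [::] -> I f -> I (Tr (f * word_mono F v));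
  tideal_tr : forall f, no_pure_term f -> I f -> I (Tr f)
}.

Definition trace_T_ideal_gen (S : tpoly F -> Prop) (f : tpoly F) : Prop :=
  forall I, trace_T_ideal I -> (forall g, S g -> I g) -> I f.

(* The trace monomial Tr(v_1) ... Tr(v_r) w, for vs = [:: v_1; ...; v_r]. *)
Definition trace_mono (vs : seq (seq nat)) (w : seq nat) : tpoly F :=
  (\prod_(v <- vs) Tr (word_mono F v)) * word_mono F w.

Definition multilinear_mono (n : nat) (vs : seq (seq nat)) (w : seq nat) : bool :=
  ([::] \notin vs) && perm_eq (flatten vs ++ w) (iota 0 n).

Definition MT (n : nat) (f : tpoly F) : Prop :=
  exists r (c : 'I_r -> F) (vs : 'I_r -> seq (seq nat)) (w : 'I_r -> seq nat),
    (forall i, multilinear_mono n (vs i) (w i)) /\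
    f = \sum_i fscale (c i) (trace_mono (vs i) (w i)).

(* dim_F V / W = d, for F-subspaces W of V: d elements of V form a basis
   modulo W. *)
Definition dim_quot (V W : tpoly F -> Prop) (d : nat) : Prop :=
  exists b : 'I_d -> tpoly F,
    [/\ forall i, V (b i),
        forall f, V f -> exists c : 'I_d -> F, W (f - \sum_i fscale (c i) (b i))
      & forall c : 'I_d -> F, W (\sum_i fscale (c i) (b i)) -> forall i, c i = 0].

(* c_n^tr(A) = d. *)
Definition trace_codim (A : algType F) (t : trace_map A) (n d : nat) : Prop :=
  dim_quot (MT n) (fun f => MT n f /\ trace_identity t f) d.

End TraceIdeals.

Section Diagonal.
Variable F : fieldType.

Definition is_diag3 : {pred 'M[F]_3} := fun M => is_diag_mx M.

Lemma is_diag3_closed : GRing.subsemialg_closed is_diag3.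
Proof.
split; rewrite /is_diag3.
- exact: scalar_mx_is_diag.
- split=> [|_ _ /diag_mxP[d ->] /diag_mxP[e ->]]; first exact: mx0_is_diag.
  by rewrite -raddfD; apply: diag_mx_is_diag.
- by move=> c _ /diag_mxP[d ->]; rewrite -linearZ; apply: diag_mx_is_diag.
- move=> _ _ /diag_mxP[d ->] /diag_mxP[e ->].
  by rewrite -[_ * _]/(_ *m _) mulmx_diag; apply: diag_mx_is_diag.
Qed.

HB.instance Definition _ :=
  GRing.isSubalgClosed.Build F 'M[F]_3 is_diag3 is_diag3_closed.

Record diag3 := Diag3 { diag3_mx : 'M[F]_3; _ : diag3_mx \in is_diag3 }.

HB.instance Definition _ := [isSub for diag3_mx].
HB.instance Definition _ := [Choice of diag3 by <:].
HB.instance Definition _ := [SubChoice_isSubAlgebra of diag3 by <:].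

Variable alpha : F.

(* The indices 0 and 1 are those of the entries a_11 and a_22. *)
Definition diag3_tr_fun (M : diag3) : F :=
  alpha * diag3_mx M 0 0 + alpha * diag3_mx M 1 1.

Lemma diag3_tr_linear : linear_for *%R diag3_tr_fun.
Proof.
move=> c M N; rewrite /diag3_tr_fun.
have -> : diag3_mx (c *: M + N) = c *: diag3_mx M + diag3_mx N.
  by rewrite -[LHS]/(val _) linearP.
rewrite !mxE /=.
by rewrite !mulrDr !mulrA !(mulrC alpha c) addrACA.
Qed.

HB.instance Definition _ :=
  GRing.isLinear.Build F diag3 F *%R diag3_tr_fun diag3_tr_linear.

Lemma diag3_mulC (M N : diag3) : M * N = N * M.
Proof.
apply: val_inj; rewrite !rmorphM; case: M N => [M /= HM] [N /= HN].
have /diag_mxP[d ->] : is_diag_mx M by [].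
have /diag_mxP[e ->] : is_diag_mx N by [].
exact: diag_mxC.
Qed.

Definition diag3_tr : trace_map diag3 :=
  @TraceMap F diag3 diag3_tr_fun (fun M N => congr1 diag3_tr_fun (diag3_mulC M N)).

Local Notation x1 := (tvar F 0).
Local Notation x2 := (tvar F 1).
Local Notation x3 := (tvar F 2).

Definition poly_f1 : tpoly F := x1 * x2 - x2 * x1.

Definition poly_g3 : tpoly F :=
  Tr x1 * Tr x2 * Tr x3 + fscale (2 * alpha ^+ 2) (Tr (x1 * x2 * x3))
  - fscale alpha (Tr x1 * Tr (x2 * x3))
  - fscale alpha (Tr x2 * Tr (x1 * x3))
  - fscale alpha (Tr (x1 * x2) * Tr x3).

End Diagonal.

(* S(n, k); partition requires the blocks to be nonempty. *)
Definition stirling2 (n k : nat) : nat :=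
  #|[set P : {set {set 'I_n}} | partition P [set: 'I_n] & #|P| == k]|.

(* Main.v *)
From HB Require Import structures.
Require Import Defs.
From mathcomp Require Import all_boot all_order all_algebra generic_quotient.
From mathcomp Require Import perm finmap ring.

Set Implicit Arguments.
Unset Strict Implicit.
Unset Printing Implicit Defensive.

Import GRing.Theory.
Local Open Scope ring_scope.
Local Open Scope quotient_scope.

(** The trace of [diag(a, b, c)] does not see [c], so a trace polynomial
    evaluates, at generic diagonal matrices with entries [a_i, b_i, c_i], to a
    combination of monomials in three sets of commuting variables. Writing
    [p(v) = Tr(v) / alpha], which takes the value [v(a) + v(b)], and [p(1) = 2],
    the orbit sums of the monomials under the exchange of [a] and [b] lift to

      [psi(m0, m1, m2) = (p(m0) p(m1) - p(m0 m1)) / 2 * m2],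

    whose value in the third diagonal entry is
    [(m0(a) m1(b) + m1(a) m0(b)) / 2 * m2(c)] ([eval_psi]).

    Modulo [f_1] all words commute, and [g_3] says exactly that multiplication
    by [p(v)] acts on the [psi] as multiplication by [v(a) + v(b)] acts on orbit
    sums:

      [p(v) psi(m0, m1, m2) = psi(v m0, m1, m2) + psi(m0, v m1, m2)]

    ([psi_paint]). By induction on the number of traces, every trace monomial is
    congruent to a combination of [psi]'s modulo every trace T-ideal that
    contains [f_1] and [g_3] ([normal_form]). If the trace polynomial is an
    identity, so is that combination, because the identities themselves form
    such an ideal ([trace_identity_ideal], [f1_identity], [g3_identity]). In
    characteristic zero distinct monomials are linearly independent functions
    ([monomials_free]), hence the combination is zero up to permuting letters
    and exchanging [m0] with [m1], operations under which [psi] is constant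
    modulo [f_1] ([psi_perm], [psi_swap]). So the identity lies in the ideal
    ([identity_gen]). No multilinearization is involved.

    The multilinear [psi]'s of degree [n] correspond to the colorings of [n]
    letters by three colors, up to the exchange of the first two, and the same
    independence makes them a basis of [MT_n] modulo the identities. The only
    coloring fixed by the exchange is the one that uses the third color alone,
    so the number of classes is [(3^n + 1) / 2] ([card_reps]). On the other side,
    [2 S(t, 2) + 2 = 2^t] for [t > 0], and the binomial formula gives the same
    value for the sum of the statement ([codim_formula]). *)

(** * Words and formal traces *)

Section Words.
Variable F : fieldType.
Implicit Types (f g : tpoly F) (c : tcoef F) (v w : seq nat).

Lemma word_prod_cat (A : nzRingType) (u : nat -> A) v w :
  word_prod u (v ++ w) = word_prod u v * word_prod u w.
Proof. by rewrite /word_prod big_cat. Qed.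

Lemma word_monoE v : word_mono F v = << FMonom v >>.
Proof.
elim: v => [|i v IH]; first by rewrite /word_mono /word_prod big_nil -fmoneE.
rewrite /word_mono /word_prod big_cons -/(word_prod _ v) -/(word_mono F v) IH.
rewrite /tvar; apply/malgP => k.
rewrite malgM_def [fgmul _ _]fgmulUU mulr1; congr (mcoeff k << _ >>).
by rewrite -[LHS]/(fmmul _ _) fmmulE fmuE.
Qed.

Lemma malg_scaleU (R : nzRingType) (K : choiceType) (c : R) (k : K) :
  c *: << k >> = << c *g k >> :> {malg R[K]}.
Proof. by apply/malgP=> i; rewrite mcoeffZ !mcoeffU mulr_natr. Qed.

Lemma tpoly_sum f :
  f = \sum_(m <- msupp f) f@_m *: word_mono F m.
Proof.
rewrite [LHS]monalgE; apply: eq_bigr => m _; rewrite word_monoE fmK.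
by rewrite -[RHS]/(@GRing.scale _ {malg (tcoef F)[{fmonom nat}]} _ _) malg_scaleU.
Qed.

Lemma tr_word_val (v : nonempty_word) :
  tr_word F (val v) = << ucm (\pi_cyc_word v) >>.
Proof. by rewrite /tr_word valK. Qed.

Lemma tr_word_rot v i : tr_word F (rot i v) = tr_word F v.
Proof.
have [-> //|vn] := eqVneq v [::].
have rn : rot i v != [::] by rewrite -size_eq0 size_rot size_eq0.
pose a : nonempty_word := Sub v vn; pose b : nonempty_word := Sub (rot i v) rn.
rewrite -[v]/(val a) -[rot i (val a)]/(val b) !tr_word_val.
suff -> : \pi_cyc_word b = \pi_cyc_word a by [].
by apply/esym/eqmodP; apply/cyc_relP; exists i.
Qed.

Lemma tr_word_catC v w : tr_word F (v ++ w) = tr_word F (w ++ v).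
Proof. by rewrite -(tr_word_rot _ (size v)) rot_size_cat. Qed.

Lemma tr_coef_linear : linear_for *%R (@tr_coef F).
Proof.
move=> c f g; rewrite /tr_coef raddfD /=; congr (_ + _).
rewrite (mmapEw (msuppZ_le _ _)) mmapE big_distrr /=.
by apply: eq_bigr => k _; rewrite mcoeffZ /= mulrA.
Qed.

HB.instance Definition _ :=
  GRing.isLinear.Build (tcoef F) (tpoly F) (tcoef F) *%R (@tr_coef F)
    tr_coef_linear.

Lemma tr_coef_word v : tr_coef (word_mono F v) = tr_word F v.
Proof. by rewrite word_monoE /tr_coef mmapU /= mul1r. Qed.

Lemma TrE v : Tr (word_mono F v) = (tr_word F v)%:MP.
Proof. by rewrite /Tr tr_coef_word. Qed.

Lemma word_mono_cat v w : word_mono F (v ++ w) = word_mono F v * word_mono F w.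
Proof. exact: word_prod_cat. Qed.

Lemma word_prod_mono (w : nat -> seq nat) v :
  word_prod (fun i => word_mono F (w i)) v = word_mono F (flatten (map w v)).
Proof.
elim: v => [|i v IH]; first by rewrite /word_mono /word_prod !big_nil.
by rewrite /= word_mono_cat -IH /word_prod big_cons.
Qed.

Lemma no_pure_termM f g :
  no_pure_term f -> no_pure_term (f * g).
Proof. by rewrite /no_pure_term => f0; rewrite rmorphM /= f0 mul0r. Qed.

Lemma no_pure_word v : v != [::] -> no_pure_term (word_mono F v).
Proof.
rewrite /no_pure_term word_monoE mcoeffU -[mone]/(fmone _) fmoneE.
by rewrite -val_eqE /= => /negbTE ->.
Qed.

End Words.

(** * Evaluation of trace polynomials *)

Section EvalTheory.
Variables (F : fieldType) (K : comNzRingType) (A : lalgType K).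
Variables (iota : {rmorphism F -> K}) (t : {scalar A}) (u : nat -> A).
Implicit Types (f g : tpoly F) (c : tcoef F) (v w : seq nat).

(* The value of a product of traces: it is multiplicative, whence eval_coef is a
   ring morphism. *)
Let trace_mono_val (k : {cmonom cyc_word}) : K :=
  \prod_(c <- finsupp k) t (word_prod u (val (repr c))) ^+ k c.

Lemma trace_mono_valEw (d : {fset cyc_word}) (k : {cmonom cyc_word}) :
  (finsupp k `<=` d)%fset ->
  trace_mono_val k = \prod_(c <- d) t (word_prod u (val (repr c))) ^+ k c.
Proof.
move=> kd; rewrite /trace_mono_val (big_fset_incl _ kd) // => c _.
by rewrite -cmE_neq0 negbK => /eqP ->; rewrite expr0.
Qed.

Lemma trace_mono_val_mmorphism : mmorphism trace_mono_val.
Proof.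
split=> [k1 k2|].
  rewrite (trace_mono_valEw (fsubsetUl (finsupp k1) (finsupp k2))).
  rewrite (trace_mono_valEw (fsubsetUr (finsupp k1) (finsupp k2))) -big_split.
  rewrite (trace_mono_valEw (d := finsupp k1 `|` finsupp k2)%fset) ?mdomD //.
  by apply: eq_bigr => c _; rewrite cmM exprD.
by rewrite /trace_mono_val mdom1 big_seq_fset0.
Qed.

HB.instance Definition _ :=
  monalg.isMultiplicative.Build {cmonom cyc_word} K trace_mono_val trace_mono_val_mmorphism.

Local Notation evc := (eval_coef iota t u).
Local Notation ev := (eval_tpoly iota t u).

HB.instance Definition _ := GRing.RMorphism.copy evc (mmap iota trace_mono_val).

Lemma eval_coef_alg (a : F) : evc a%:A = iota a.
Proof.
have ->: a%:A = a%:MP :> tcoef F by rewrite -mul_malgC mulr1.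
exact: (@mmapC _ _ _ iota trace_mono_val).
Qed.

Lemma eval_coef_ucm (x : cyc_word) :
  evc << ucm x >> = t (word_prod u (val (repr x))).
Proof.
have -> : evc << ucm x >> = iota 1 * trace_mono_val (ucm x) by exact: mmapU.
by rewrite rmorph1 mul1r /trace_mono_val mdomU big_seq_fset1 cmUU expr1.
Qed.

(** The evaluation of [Tr(v)] goes through the representative chosen in the class
    of rotations of [v]; the hypothesis makes that choice harmless. It is weaker
    than traciality of [t], so that it can be checked for the formal trace on
    words alone. *)
Lemma eval_coef_tr_word v :
  (forall w i, t (word_prod u (rot i w)) = t (word_prod u w)) ->
  v != [::] -> evc (tr_word F v) = t (word_prod u v).
Proof.
move=> tC vn; rewrite /tr_word insubT eval_coef_ucm.
set w := Sub v vn; have : cyc_rel w (repr (\pi_cyc_word w)).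
  by apply/eqmodP; rewrite reprK.
by case/cyc_relP => i <-; rewrite tC.
Qed.

Lemma eval_tpolyEw (d : {fset {fmonom nat}}) f : (msupp f `<=` d)%fset ->
  ev f = \sum_(m <- d) evc f@_m *: word_prod u m.
Proof.
move=> fd; rewrite /eval_tpoly (big_fset_incl _ fd) // => m _ /mcoeff_outdom ->.
by rewrite rmorph0 scale0r.
Qed.

Lemma eval_tpoly_additive : additive ev.
Proof.
move=> f g; rewrite (eval_tpolyEw (fsubsetUl (msupp f) (msupp g))).
rewrite (eval_tpolyEw (fsubsetUr (msupp f) (msupp g))).
rewrite (eval_tpolyEw (msuppB_le _ _)) -sumrB.
by apply: eq_bigr => m _; rewrite mcoeffB rmorphB scalerBl.
Qed.

HB.instance Definition _ :=
  GRing.isAdditive.Build (tpoly F) A ev eval_tpoly_additive.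

Lemma eval_tpolyZ c f : ev (c *: f) = evc c *: ev f.
Proof.
rewrite (eval_tpolyEw (msuppZ_le _ _)) scaler_sumr.
by apply: eq_bigr => m _; rewrite mcoeffZ rmorphM scalerA.
Qed.

Lemma eval_tpoly_word v : ev (word_mono F v) = word_prod u v.
Proof.
rewrite word_monoE (eval_tpolyEw msuppU_le) big_seq_fset1 mcoeffUU rmorph1.
by rewrite scale1r.
Qed.

Lemma eval_tpolyC c : ev c%:MP = (evc c)%:A.
Proof.
have ->: c%:MP = c *: word_mono F [::].
  by rewrite -mul_malgC /word_mono /word_prod big_nil mulr1.
by rewrite eval_tpolyZ eval_tpoly_word /word_prod big_nil.
Qed.

(** A pure term has to be excluded: the formal trace of [1] is the dummy [0],
    which differs from [t 1] in general. *)
Lemma eval_coef_tr f :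
  (forall w i, t (word_prod u (rot i w)) = t (word_prod u w)) ->
  no_pure_term f -> evc (tr_coef f) = t (ev f).
Proof.
move=> tC f0; rewrite /tr_coef mmapE rmorph_sum /eval_tpoly linear_sum.
apply: eq_big_seq => m mf; rewrite rmorphM linearZ /= eval_coef_tr_word //.
apply: contraTneq mf => m0; rewrite -mcoeff_eq0; apply/eqP.
by rewrite -[RHS]f0; congr mcoeff; apply: val_inj; rewrite /= m0 fm1.
Qed.

End EvalTheory.

(** * Trace identities form a trace T-ideal *)

Section TraceIdentities.
Variables (F : fieldType) (A : algType F) (t : trace_map A).
Implicit Types (f g : tpoly F) (u : nat -> A).

Local Notation evc u := (eval_coef idfun t u).
Local Notation ev u := (eval_tpoly idfun t u).

Lemma trace_word_rot u v i : t (word_prod u (rot i v)) = t (word_prod u v).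
Proof.
by rewrite -[in RHS](cat_take_drop i v) /rot !word_prod_cat trace_mulC.
Qed.

Lemma eval_tpolyU u (c : tcoef F) (m : {fmonom nat}) :
  ev u << c *g m >> = evc u c *: word_prod u m.
Proof.
by rewrite (eval_tpolyEw _ _ _ msuppU_le) big_seq_fset1 mcoeffUU.
Qed.

Lemma eval_tpolyM u f g : ev u (f * g) = ev u f * ev u g.
Proof.
rewrite -[f * g]/(fgmul f g) /fgmul raddf_sum /= {2}/eval_tpoly mulr_suml.
apply: eq_bigr => m1 _; rewrite raddf_sum /= {2}/eval_tpoly mulr_sumr.
apply: eq_bigr => m2 _; rewrite eval_tpolyU rmorphM fmM word_prod_cat.
by rewrite -scalerAl -scalerAr scalerA.
Qed.

Lemma eval_word_prod u (s : nat -> tpoly F) (v : seq nat) :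
  ev u (word_prod s v) = word_prod (fun i => ev u (s i)) v.
Proof.
elim: v => [|i v IH].
  have := eval_tpoly_word idfun t u [::].
  by rewrite /word_mono /word_prod !big_nil.
by rewrite /word_prod !big_cons eval_tpolyM; congr (_ * _).
Qed.

Lemma eval_Tr u f : no_pure_term f -> ev u (Tr f) = (t (ev u f))%:A.
Proof.
move=> f0; rewrite eval_tpolyC eval_coef_tr //; exact: trace_word_rot.
Qed.

Lemma no_pure_word_prod (s : nat -> tpoly F) (v : seq nat) :
  (forall i, no_pure_term (s i)) -> v != [::] -> no_pure_term (word_prod s v).
Proof.
by case: v => // i v s0 _; rewrite /word_prod big_cons; apply: no_pure_termM.
Qed.

Lemma eval_coef_subst u (s : nat -> tpoly F) (c : tcoef F) :
  (forall i, no_pure_term (s i)) ->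
  evc u (eval_coef (in_alg (tcoef F)) (@tr_coef F) s c) =
  evc (fun i => ev u (s i)) c.
Proof.
move=> s0.
rewrite [eval_coef (in_alg _) _ _ _]/eval_coef mmapE rmorph_sum [RHS]/eval_coef mmapE.
apply: eq_bigr => k _; rewrite rmorphM /= eval_coef_alg; congr (_ * _).
rewrite rmorph_prod; apply: eq_bigr => x _; rewrite rmorphXn /=.
rewrite eval_coef_tr; last 2 first.
- exact: trace_word_rot.
- by apply: no_pure_word_prod => //; exact: (valP (repr x)).
by rewrite eval_word_prod.
Qed.

(** Evaluating after a substitution is evaluating at the substituted values: this
    gives the closure of the identities under endomorphisms. *)
Lemma eval_tsubst u (s : nat -> tpoly F) f :
  (forall i, no_pure_term (s i)) ->
  ev u (tsubst s f) = ev (fun i => ev u (s i)) f.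
Proof.
move=> s0; rewrite /tsubst [eval_tpoly _ _ s f]/eval_tpoly raddf_sum.
rewrite [RHS]/eval_tpoly.
apply: eq_bigr => m _ /=.
rewrite eval_tpolyZ eval_word_prod.
by rewrite (eval_coef_subst _ _ s0).
Qed.

Lemma trace_identity_ideal : trace_T_ideal (trace_identity t).
Proof.
split.
- by move=> u; rewrite raddf0.
- by move=> f g If Ig u; rewrite raddfD /= If Ig addr0.
- by move=> f g Ig u; rewrite eval_tpolyM Ig mulr0.
- by move=> f g If u; rewrite eval_tpolyM If mul0r.
- by move=> s s0 f If u; rewrite eval_tsubst.
- move=> f v vn If u; rewrite eval_Tr ?eval_tpolyM ?If ?mul0r ?linear0 ?scale0r //.
  rewrite /no_pure_term rmorphM /= [X in _ * X](no_pure_word F vn) mulr0 //.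
- by move=> f f0 If u; rewrite eval_Tr // If linear0 scale0r.
Qed.

End TraceIdentities.

(** * Linear independence of monomials in characteristic zero *)

Section MonomialFunctions.

Definition nth_prime (n : nat) : nat :=
  iter n.+1 (fun m => s2val (prime_above m)) 0.

Lemma nth_prime_prime n : prime (nth_prime n).
Proof. by rewrite /nth_prime /=; case: prime_above. Qed.

Lemma nth_prime_inj : injective nth_prime.
Proof.
have lt_nth_prime i : (nth_prime i < nth_prime i.+1)%N.
  change (nth_prime i < s2val (prime_above (nth_prime i)))%N.
  by case: prime_above.
by apply: incn_inj; apply: leq_mono; apply: homo_ltn lt_nth_prime; apply: ltn_trans.
Qed.

Variable T : countType.
Implicit Types (k : seq T).

(** The value at the word [k] of the point whose coordinates are distinct primes:
    by unique factorization a single number separates all monomials. *)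
Definition godel k : nat := \prod_(x <- k) nth_prime (choice.pickle x).

Lemma godel_gt0 k : (0 < godel k)%N.
Proof. by rewrite prodn_gt0 // => x; rewrite prime_gt0 ?nth_prime_prime. Qed.

Lemma logn_godel k x : logn (nth_prime (choice.pickle x)) (godel k) = count_mem x k.
Proof.
elim: k => [|y k IH]; first by rewrite /godel big_nil logn1.
rewrite /godel big_cons lognM ?godel_gt0 ?prime_gt0 ?nth_prime_prime // IH /=.
congr (_ + _)%N; rewrite logn_prime ?nth_prime_prime //.
by rewrite (inj_eq nth_prime_inj) (inj_eq (pcan_inj choice.pickleK)) eq_sym.
Qed.

Lemma godel_perm k k' : (godel k == godel k') = perm_eq k k'.
Proof.
apply/eqP/idP => [kk'|kk']; last exact: perm_big.
by apply/allP => x _ /=; rewrite -!logn_godel kk'.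
Qed.

Variable F : fieldType.

(** The hypothesis extends from powers to all polynomials in [N i], and a
    polynomial that vanishes at every value of [N] but [z] isolates the fibre of
    [z]. *)
Lemma power_sums_free (I : eqType) (r : seq I) (a N : I -> F) :
  (forall e, \sum_(i <- r) a i * N i ^+ e = 0) ->
  forall z, \sum_(i <- r | N i == z) a i = 0.
Proof.
move=> sum0 z.
have sum_poly (q : {poly F}) : \sum_(i <- r) a i * q.[N i] = 0.
  under eq_bigr => i _ do rewrite horner_coef mulr_sumr.
  rewrite exchange_big big1 // => j _ /=.
  under eq_bigr => i _ do rewrite mulrCA.
  by rewrite -mulr_sumr sum0 mulr0.
pose s := [seq y <- undup (map N r) | y != z].
pose q : {poly F} := \prod_(y <- s) ('X - y%:P).
have qz : q.[z] != 0.
  rewrite -/(root q z) root_prod_XsubC mem_filter eqxx //.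
apply: (mulIf qz); rewrite mul0r mulr_suml -[RHS](sum_poly q).
rewrite [RHS](bigID (fun i => N i == z)) /= [X in _ + X]big_seq_cond.
rewrite [X in _ + X]big1 ?addr0 => [|i /andP[ir Niz]].
  by apply: eq_bigr => i /eqP ->.
suff /rootP -> : root q (N i) by rewrite mulr0.
by rewrite root_prod_XsubC mem_filter Niz mem_undup map_f.
Qed.

Hypothesis charF0 : [pchar F] =i pred0.

Lemma natF_inj : injective (fun n : nat => n%:R : F).
Proof.
have natF_neq0 n : n.+1%:R != 0 :> F by rewrite ((pcharf0P F).1 charF0).
move=> m n; wlog lemn : m n / (m <= n)%N => [H|].
  by case/orP: (leq_total m n) => /H // H' /esym /H'.
move=> /eqP; rewrite eq_sym -subr_eq0 -natrB //.
case E: (n - m)%N => [|k]; last by rewrite (negbTE (natF_neq0 k)).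
by move=> _; apply/eqP; rewrite eqn_leq lemn -subn_eq0 E.
Qed.

(** It is enough to evaluate at the powers of the point of primes: the monomials
    take distinct natural values there, so a Vandermonde argument applies. *)
Lemma monomials_free (I : eqType) (r : seq I) (a : I -> F) (k : I -> seq T) :
  (forall u : T -> F, \sum_(i <- r) a i * \prod_(x <- k i) u x = 0) ->
  forall k0, \sum_(i <- r | perm_eq (k i) k0) a i = 0.
Proof.
move=> sum0 k0.
have -> : \sum_(i <- r | perm_eq (k i) k0) a i =
          \sum_(i <- r | (godel (k i))%:R == (godel k0)%:R :> F) a i.
  by apply: eq_bigl => i; rewrite (inj_eq natF_inj) godel_perm.
apply: (@power_sums_free _ r a (fun i => (godel (k i))%:R)) => e.
rewrite -[RHS](sum0 (fun x => (nth_prime (choice.pickle x))%:R ^+ e)).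
by apply: eq_bigr => i _; rewrite /godel natr_prod prodrXl.
Qed.

(** The form in which independence is used: any [g] that is defined on monomials,
    that is, insensitive to the order of letters, kills a combination whose value
    is identically zero. The first argument of [g] stands for a scalar, so
    that trace polynomials, on which the base field acts by [fscale], are
    covered. *)
Lemma monomials_free_sum (I : eqType) (r : seq I) (a : I -> F)
    (k : I -> seq T) (V : zmodType) (g : F -> seq T -> V) :
  (forall b c k0, g (b + c) k0 = g b k0 + g c k0) ->
  (forall b k1 k2, perm_eq k1 k2 -> g b k1 = g b k2) ->
  (forall u : T -> F, \sum_(i <- r) a i * \prod_(x <- k i) u x = 0) ->
  \sum_(i <- r) g (a i) (k i) = 0.
Proof.
move=> gD gperm /monomials_free sum0.
have g0 k0 : g 0 k0 = 0 by apply: (addrI (g 0 k0)); rewrite -gD !addr0.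
pose s := undup [seq godel (k i) | i <- r].
have -> : \sum_(i <- r) g (a i) (k i) =
          \sum_(n <- s) \sum_(i <- r | godel (k i) == n) g (a i) (k i).
  rewrite (exchange_big_dep predT) //= big_seq [RHS]big_seq.
  apply: eq_bigr => i ir.
  transitivity (\sum_(n <- s | pred1 (godel (k i)) n) g (a i) (k i)); last first.
    by apply: eq_bigl => n; apply: eq_sym.
  rewrite -big_filter filter_pred1_uniq ?undup_uniq ?mem_undup //; last first.
    by apply/mapP; exists i.
  by rewrite big_seq1.
rewrite big_seq big1 // => n; rewrite mem_undup => /mapP[j jr ->].
under eq_bigl => i do rewrite godel_perm.
rewrite (eq_bigr (fun i => g (a i) (k j))) => [|i kij]; last exact: gperm.
by rewrite -(big_morph (g^~ (k j)) (fun b c => gD b c (k j)) (g0 (k j))) sum0.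
Qed.

End MonomialFunctions.

(** * Colored words and the elements psi *)

(** The expression of [g_3] in an arbitrary ring, so that its images under several
    morphisms are computed at once. The subscripts of [t] name the letters inside
    the trace. *)
Definition g3_form (R : nzRingType) (b a t0 t1 t2 t01 t02 t12 t012 : R) : R :=
  t0 * t1 * t2 + b * t012 - a * (t0 * t12) - a * (t1 * t02) - a * (t01 * t2).

Lemma rmorph_g3_form (R S : nzRingType) (f : {rmorphism R -> S})
    (b a t0 t1 t2 t01 t02 t12 t012 : R) (b' a' s0 s1 s2 s01 s02 s12 s012 : S) :
  f b = b' -> f a = a' -> f t0 = s0 -> f t1 = s1 -> f t2 = s2 -> f t01 = s01 ->
  f t02 = s02 -> f t12 = s12 -> f t012 = s012 ->
  f (g3_form b a t0 t1 t2 t01 t02 t12 t012) =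
  g3_form b' a' s0 s1 s2 s01 s02 s12 s012.
Proof.
by do 9!move <-; rewrite /g3_form !(rmorphB, rmorphD, rmorphM).
Qed.

Section Colored.
Variable F : fieldType.
Variable alpha : F.
Implicit Types (v w : seq nat) (vs : seq (seq nat)).

(** A colored word is a monomial in the entries of generic diagonal matrices: the
    letter [(i, c)] is the [c]-th diagonal entry of the [i]-th matrix. *)
Definition colored_word := seq (nat * 'I_3).
Implicit Types (k : colored_word).

Definition paint (c : 'I_3) v : colored_word := [seq (i, c) | i <- v].
Definition part (c : 'I_3) k : seq nat := [seq x.1 | x <- k & x.2 == c].
Definition swap k : colored_word := [seq (x.1, tperm 0 1 x.2) | x <- k].

(** The monomials obtained by expanding
    [(v_1(a) + v_1(b)) ... (v_r(a) + v_r(b)) w(c)]. *)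
Fixpoint colorings vs w : seq colored_word :=
  if vs is v :: vs' then
    [seq paint 0 v ++ k | k <- colorings vs' w] ++
    [seq paint 1 v ++ k | k <- colorings vs' w]
  else [:: paint 2 w].

(** The lift of the power sum [v(a) + v(b)]; at the empty word this is [2], a
    value that no formal trace provides. *)
Definition psum v : tcoef F :=
  if v is [::] then 2 else (alpha^-1)%:A * tr_word F v.

(** The lift of half the orbit sum [v(a) w(b) + w(a) v(b)]. *)
Definition psi_coef v w : tcoef F :=
  (2^-1 : F)%:A * (psum v * psum w - psum (v ++ w)).

Definition psi k : tpoly F :=
  psi_coef (part 0 k) (part 1 k) *: word_mono F (part 2 k).

Lemma part_cat c k1 k2 : part c (k1 ++ k2) = part c k1 ++ part c k2.
Proof. by rewrite /part filter_cat map_cat. Qed.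

Lemma part_paint c c' v : part c (paint c' v) = if c' == c then v else [::].
Proof.
rewrite /part /paint filter_map /preim /=; case: (c' == c).
  by rewrite filter_predT -map_comp map_id.
by rewrite filter_pred0.
Qed.

Lemma part_perm c k k' : perm_eq k k' -> perm_eq (part c k) (part c k').
Proof. by move=> kk'; apply/perm_map/perm_filter. Qed.

Lemma part_swap c k : part c (swap k) = part (tperm 0 1 c) k.
Proof.
rewrite /part /swap filter_map -map_comp; congr map.
apply: eq_filter => x /=.
by rewrite -(inj_eq (@perm_inj _ (tperm 0 1))) tpermK.
Qed.

Definition g3_coef : tcoef F :=
  let T := tr_word F in
  g3_form (2 * alpha ^+ 2)%:A alpha%:A (T [:: 0]%N) (T [:: 1]%N) (T [:: 2]%N)
    (T [:: 0; 1]%N) (T [:: 0; 2]%N) (T [:: 1; 2]%N) (T [:: 0; 1; 2]%N).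

Lemma poly_g3E : poly_g3 alpha = g3_coef%:MP.
Proof.
(* cst is the embedding of the coefficients, known only through its laws. *)
have [cst cstE] : {cst : tcoef F -> tpoly F | forall c, cst c = c%:MP}.
  by exists (fun c => c%:MP).
have TC v : Tr (word_mono F v) = cst (tr_word F v) by rewrite cstE TrE.
have x1 i : tvar F i = word_mono F [:: i] by rewrite /word_mono /word_prod big_seq1.
have sC a c : fscale a (cst c) = cst (a%:A * c).
  by rewrite !cstE /fscale rmorphM /= mul_malgC.
have MC a b : cst a * cst b = cst (a * b) by rewrite !cstE rmorphM.
have DC a b : cst a + cst b = cst (a + b) by rewrite !cstE raddfD.
have BC a b : cst a - cst b = cst (a - b) by rewrite !cstE raddfB.
by rewrite -cstE /poly_g3 !x1 -!word_mono_cat !TC !(MC, sC, DC, BC).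
Qed.

End Colored.

(** * Congruences modulo a trace T-ideal *)

Section RingCongruence.
Variables (R : comNzRingType) (J : R -> Prop).
Implicit Types c d e : R.

(** Ideals as predicates into [Prop], like the trace T-ideals that they come
    from. *)
Record ring_ideal : Prop := {
  ring_ideal0 : J 0;
  ring_idealD : forall c d, J c -> J d -> J (c + d);
  ring_idealM : forall c d, J d -> J (c * d)
}.

Definition congr_mod c d := J (c - d).

Hypothesis idealJ : ring_ideal.

Lemma congr_refl c : congr_mod c c.
Proof. by rewrite /congr_mod subrr; apply: ring_ideal0. Qed.

Lemma congr_trans c d e : congr_mod c d -> congr_mod d e -> congr_mod c e.
Proof. by move=> cd de; rewrite /congr_mod -(subrKA d); apply: ring_idealD. Qed.

Lemma congrD c c' d d' :
  congr_mod c c' -> congr_mod d d' -> congr_mod (c + d) (c' + d').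
Proof. by move=> cc' dd'; rewrite /congr_mod opprD addrACA; apply: ring_idealD. Qed.

Lemma congrMl c d d' : congr_mod d d' -> congr_mod (c * d) (c * d').
Proof. by move=> dd'; rewrite /congr_mod -mulrBr; apply: ring_idealM. Qed.

Lemma congrN c d : congr_mod c d -> congr_mod (- c) (- d).
Proof. by rewrite -[- c]mulN1r -[- d]mulN1r; apply: congrMl. Qed.

Lemma congrM c c' d d' :
  congr_mod c c' -> congr_mod d d' -> congr_mod (c * d) (c' * d').
Proof.
move=> cc' dd'; apply: (@congr_trans _ (c * d')); first exact: congrMl.
by rewrite ![_ * d']mulrC; apply: congrMl.
Qed.

End RingCongruence.

Section IdealCongruence.
Variables (F : fieldType) (I : tpoly F -> Prop).
Hypothesis idealI : trace_T_ideal I.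
Implicit Types (f g h : tpoly F) (c d : tcoef F) (v w : seq nat).

Lemma idealZ c f : I f -> I (c *: f).
Proof. by move=> If; rewrite -mul_malgC; apply: (tidealMl idealI). Qed.

Lemma idealZl c f : I c%:MP -> I (c *: f).
Proof. by move=> Ic; rewrite -mul_malgC; apply: (tidealMr idealI). Qed.

Lemma idealN f : I f -> I (- f).
Proof. by move=> If; rewrite -scaleN1r; apply: idealZ. Qed.

Lemma ideal_sum (J : Type) (r : seq J) (P : pred J) (f : J -> tpoly F) :
  (forall j, P j -> I (f j)) -> I (\sum_(j <- r | P j) f j).
Proof.
by move=> If; apply: big_ind => //; [apply: tideal0|apply: tidealD].
Qed.

Definition tcongr f g := I (f - g).

Lemma tcongr_refl f : tcongr f f.
Proof. by rewrite /tcongr subrr; apply: tideal0. Qed.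

Lemma tcongr_sym f g : tcongr f g -> tcongr g f.
Proof. by rewrite /tcongr -[g - f]opprB; apply: idealN. Qed.

Lemma tcongr_trans g f h : tcongr f g -> tcongr g h -> tcongr f h.
Proof. by move=> fg gh; rewrite /tcongr -(subrKA g); apply: (tidealD idealI). Qed.

Lemma tcongr_ideal f g : tcongr f g -> I g -> I f.
Proof. by move=> fg Ig; rewrite -(subrK g f); apply: (tidealD idealI). Qed.

Lemma tcongrD f f' g g' : tcongr f f' -> tcongr g g' -> tcongr (f + g) (f' + g').
Proof. by move=> ff' gg'; rewrite /tcongr opprD addrACA; apply: (tidealD idealI). Qed.

Lemma tcongrZ c f g : tcongr f g -> tcongr (c *: f) (c *: g).
Proof. by move=> fg; rewrite /tcongr -scalerBr; apply: idealZ. Qed.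

Lemma tcongr_sum (J : Type) (r : seq J) (f g : J -> tpoly F) :
  (forall j, tcongr (f j) (g j)) -> tcongr (\sum_(j <- r) f j) (\sum_(j <- r) g j).
Proof. by move=> fg; rewrite /tcongr -sumrB; apply: ideal_sum => j _; apply: fg. Qed.

(** The pure trace polynomials of the ideal; they form an ideal of the
    commutative ring of coefficients, where most of the computation takes
    place. *)
Definition coef_ideal c := I c%:MP.

Lemma coef_ideal0 : coef_ideal 0.
Proof. by rewrite /coef_ideal malgC0E; apply: tideal0. Qed.

Lemma coef_idealD c d : coef_ideal c -> coef_ideal d -> coef_ideal (c + d).
Proof. by move=> Ic Id; rewrite /coef_ideal monalgUD; exact: (tidealD idealI Ic Id). Qed.

Lemma coef_idealM c d : coef_ideal d -> coef_ideal (c * d).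
Proof. by move=> Id; rewrite /coef_ideal rmorphM; exact: (tidealMl idealI c%:MP Id). Qed.

Local Notation congC := (congr_mod coef_ideal).

Lemma ideal_coef : ring_ideal coef_ideal.
Proof. by split; [exact: coef_ideal0 | exact: coef_idealD | exact: coef_idealM]. Qed.

Lemma tcongrZl c d f : congC c d -> tcongr (c *: f) (d *: f).
Proof. by move=> cd; rewrite /tcongr -scalerBl; apply: idealZl. Qed.

Hypothesis If1 : I (poly_f1 F).

Lemma tsubst_word (w : nat -> seq nat) v :
  tsubst (fun i => word_mono F (w i)) (word_mono F v) =
  word_mono F (flatten (map w v)).
Proof.
by rewrite /tsubst (eval_tpoly_word (in_alg (tcoef F)) (@tr_coef F)) word_prod_mono.
Qed.

(** Substitute the words [v] and [w] for the variables of [f_1]. *)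
Lemma word_swap v w : tcongr (word_mono F (v ++ w)) (word_mono F (w ++ v)).
Proof.
have [->|vn] := eqVneq v [::]; first by rewrite cats0; apply: tcongr_refl.
have [->|wn] := eqVneq w [::]; first by rewrite cats0; apply: tcongr_refl.
pose s i := if i is 0%N then v else w.
have s0 i : no_pure_term (word_mono F (s i)) by apply: no_pure_word; case: i.
have := tideal_subst idealI s0 If1.
have x1 i : tvar F i = word_mono F [:: i] by rewrite /word_mono /word_prod big_seq1.
rewrite /poly_f1 !x1 -!word_mono_cat.
rewrite -[tsubst _ _]/(eval_tpoly (in_alg (tcoef F)) (@tr_coef F) _ _) raddfB /=.
by rewrite -!/(tsubst _ _) !tsubst_word /= !cats0.
Qed.

Lemma word_perm v w : perm_eq v w -> tcongr (word_mono F v) (word_mono F w).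
Proof.
move=> vw; apply: (@catCA_perm_ind _ (fun z => tcongr (word_mono F v) (word_mono F z)) _ v w) => //.
  move=> s1 s2 s3 vs; apply: (tcongr_trans vs).
  rewrite !catA !(word_mono_cat _ (_ ++ _)) /tcongr -mulrBl.
  by apply: (tidealMr idealI); apply: word_swap.
exact: tcongr_refl.
Qed.

(** Take the trace of [word_perm], which is allowed as nonempty words have no
    pure term. *)
Lemma tr_word_perm v w : perm_eq v w -> congC (tr_word F v) (tr_word F w).
Proof.
have [->|vn] := eqVneq v [::].
  by rewrite perm_sym => /perm_nilP ->; apply: congr_refl ideal_coef _.
move=> vw; have wn : w != [::].
  by apply: contraNneq vn => w0; rewrite -size_eq0 (perm_size vw) w0.
have := tideal_tr idealI _ (word_perm vw); rewrite /Tr linearB /= !tr_coef_word.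
apply; rewrite /no_pure_term mcoeffB.
by rewrite [X in X - _](no_pure_word F vn) [X in _ - X](no_pure_word F wn) subrr.
Qed.

Variable alpha : F.
Hypothesis Ig3 : I (poly_g3 alpha).

(** Substitute the words [a], [b] and [c] for the variables of [g_3]. *)
Lemma g3_words (a b c : seq nat) : a != [::] -> b != [::] -> c != [::] ->
  coef_ideal (g3_form (2 * alpha ^+ 2)%:A alpha%:A
        (tr_word F a) (tr_word F b) (tr_word F c) (tr_word F (a ++ b))
        (tr_word F (a ++ c)) (tr_word F (b ++ c)) (tr_word F (a ++ b ++ c))).
Proof.
move=> an bn cn.
pose s i := if i is i'.+1 then if i' is 0%N then b else c else a.
have s0 i : no_pure_term (word_mono F (s i)).
  by apply: no_pure_word; case: i => [|[|]].
pose u i := word_mono F (s i).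
have uC v i : tr_coef (word_prod u (rot i v)) = tr_coef (word_prod u v).
  rewrite /u !word_prod_mono !tr_coef_word /rot map_cat flatten_cat.
  by rewrite tr_word_catC -flatten_cat -map_cat cat_take_drop.
have evT v : v != [::] ->
    eval_coef (in_alg (tcoef F)) (@tr_coef F) u (tr_word F v) = tr_word F (flatten (map s v)).
  move=> vn; rewrite (eval_coef_tr_word (in_alg (tcoef F)) (t := @tr_coef F) uC vn).
  by rewrite /u word_prod_mono /= tr_coef_word.
have cA (x : tcoef F) : x%:A = x%:MP :> tpoly F by rewrite -mul_malgC mulr1.
have Ig : coef_ideal (eval_coef (in_alg (tcoef F)) (@tr_coef F) u (g3_coef alpha)).
  have := tideal_subst idealI s0 Ig3; rewrite poly_g3E /tsubst.
  by rewrite (eval_tpolyC (in_alg (tcoef F)) (@tr_coef F)) cA.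
have evA x := eval_coef_alg (in_alg (tcoef F)) (@tr_coef F) u x.
have e0 := evT [:: 0]%N isT; have e1 := evT [:: 1]%N isT; have e2 := evT [:: 2]%N isT.
have e01 := evT [:: 0; 1]%N isT; have e02 := evT [:: 0; 2]%N isT.
have e12 := evT [:: 1; 2]%N isT; have e012 := evT [:: 0; 1; 2]%N isT.
rewrite /= cats0 in e0; rewrite /= cats0 in e1; rewrite /= cats0 in e2.
rewrite /= cats0 in e01; rewrite /= cats0 in e02; rewrite /= cats0 in e12.
rewrite /= cats0 in e012.
pose f := GRing.RMorphism.clone _ _ (eval_coef (in_alg (tcoef F)) (@tr_coef F) u) _.
have := @rmorph_g3_form _ _ f _ _ _ _ _ _ _ _ _ _ _ _ _ _ _ _ _ _
  (evA (2 * alpha ^+ 2)) (evA alpha) e0 e1 e2 e01 e02 e12 e012.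
by move=> <-.
Qed.

End IdealCongruence.

(** * Reduction of trace monomials by g_3 *)

Section NormalForm.

(** [g_3] in terms of the normalized traces [p = Tr / a], rearranged as the rule
    for multiplying [p1 p2 - p12] by [p0]. The trace of the product occurs there
    with the letters in two orders, [p012] and [p102]. *)
Lemma g3_form_normalized (R : comNzRingType) (J : R -> Prop)
    (a b p0 p1 p2 p01 p02 p12 p012 p102 : R) :
  ring_ideal J -> a * b = 1 ->
  J (g3_form (2 * a ^+ 2) a (a * p0) (a * p1) (a * p2) (a * p01) (a * p02)
      (a * p12) (a * p012)) ->
  J (p102 - p012) ->
  J (p0 * (p1 * p2 - p12) - ((p01 * p2 - p012) + (p1 * p02 - p102))).
Proof.
move=> idealJ ab1 Jg Jp.
have -> : p0 * (p1 * p2 - p12) - ((p01 * p2 - p012) + (p1 * p02 - p102)) =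
  b ^+ 3 * g3_form (2 * a ^+ 2) a (a * p0) (a * p1) (a * p2) (a * p01) (a * p02)
      (a * p12) (a * p012) + (p102 - p012).
  set Y := LHS.
  have -> : g3_form (2 * a ^+ 2) a (a * p0) (a * p1) (a * p2) (a * p01)
     (a * p02) (a * p12) (a * p012) = a ^+ 3 * (Y - (p102 - p012)).
    by rewrite /g3_form /Y; ring.
  by rewrite mulrA -exprMn mulrC [b * a]mulrC ab1 expr1n mulr1 subrK.
by apply: (ring_idealD idealJ) => //; apply: (ring_idealM idealJ).
Qed.

Lemma congr_scaled (R : comNzRingType) (J : R -> Prop) (h x y z t : R) :
  ring_ideal J -> congr_mod J (x * y) (z + t) ->
  congr_mod J (x * (h * y)) (h * z + h * t).
Proof. by move=> idealJ e; rewrite mulrCA -mulrDr; apply: congrMl. Qed.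

Lemma scaler_swap (R : comNzRingType) (V : lmodType R) (a b c : R) (x : V) :
  (a * b) *: (c *: x) = (a * c) *: (b *: x).
Proof. by rewrite !scalerA mulrAC. Qed.

Lemma scal_algM (F : fieldType) (a b : F) :
  (a * b)%:A = a%:A * b%:A :> tcoef F.
Proof. exact: (rmorphM (in_alg (tcoef F))). Qed.

Variables (F : fieldType) (alpha : F).
Hypothesis alpha0 : alpha != 0.
Hypothesis two_neq0 : 2 != 0 :> F.

Local Notation p := (psum alpha).
Local Notation psi := (psi alpha).

Lemma psum_tr v : v != [::] -> tr_word F v = alpha%:A * p v.
Proof.
case: v => // i v _; rewrite /psum mulrA -[_%:A]/(in_alg _ _) -[X in _ = _ * X * _]/(in_alg _ _).
by rewrite -rmorphM divff // rmorph1 mul1r.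
Qed.

Variable I : tpoly F -> Prop.
Hypotheses (idealI : trace_T_ideal I) (If1 : I (poly_f1 F)).
Hypothesis Ig3 : I (poly_g3 alpha).

Local Notation congC := (congr_mod (coef_ideal I)).
Local Notation congI := (tcongr I).
Let Iring := ideal_coef idealI.

Lemma psum_perm v w : perm_eq v w -> congC (p v) (p w).
Proof.
move=> vw; case: v vw => [|i v] vw.
  by rewrite perm_sym in vw; rewrite (perm_nilP vw); apply: congr_refl.
case: w vw => [|j w] vw; first by move: (perm_nilP vw).
by apply: congrMl => //; apply: tr_word_perm.
Qed.

(** With [p(1) = 2] the relation also holds for empty [m0] or [m1], where [g_3]
    says nothing: it is then a trivial identity, up to the order of letters. *)
Lemma psum_reduce v m0 m1 : v != [::] ->
  congC (p v * (p m0 * p m1 - p (m0 ++ m1)))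
    ((p (v ++ m0) * p m1 - p (v ++ m0 ++ m1)) +
     (p m0 * p (v ++ m1) - p (m0 ++ v ++ m1))).
Proof.
move=> vn; have p102 : coef_ideal I (p (m0 ++ v ++ m1) - p (v ++ m0 ++ m1)).
  by apply: psum_perm; rewrite perm_catCA.
have [m00|m0n] := eqVneq m0 [::].
  rewrite m00 cats0 !cat0s -[p [::]]/(2 : tcoef F).
  move: (p v) (p m1) (p (v ++ m1)) => x y z; rewrite /congr_mod.
  have -> : x * (2 * y - y) - ((x * y - z) + (2 * z - z)) = 0 by ring.
  exact: ring_ideal0.
have [m10|m1n] := eqVneq m1 [::].
  move: p102; rewrite m10 !cats0 -[p [::]]/(2 : tcoef F).
  move: (p v) (p m0) (p (v ++ m0)) (p (m0 ++ v)) => x y z z'; rewrite /congr_mod.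
  by have -> : x * (y * 2 - y) - ((z * 2 - z) + (y * x - z')) = z' - z by ring.
have abn a b : a != [::] -> a ++ b != [::] :> seq nat by case: a.
have := g3_words idealI Ig3 vn m0n m1n.
rewrite (psum_tr vn) (psum_tr m0n) (psum_tr m1n) (psum_tr (abn v m0 vn)).
rewrite (psum_tr (abn v m1 vn)) (psum_tr (abn m0 m1 m0n)).
rewrite (psum_tr (abn v (m0 ++ m1) vn)).
have -> : (2 * alpha ^+ 2)%:A = 2 * alpha%:A ^+ 2 :> tcoef F.
  rewrite -[_%:A]/(in_alg (tcoef F) _) rmorphM rmorphXn /=.
  by rewrite -[2%:A]/(in_alg (tcoef F) _) rmorph_nat.
move=> Ig; apply: (g3_form_normalized (b := (alpha^-1)%:A) Iring _ Ig p102).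
by rewrite -[_%:A]/(in_alg (tcoef F) _) -[X in _ * X]/(in_alg (tcoef F) _) -rmorphM divff // rmorph1.
Qed.

Lemma psi_coef_reduce v m0 m1 : v != [::] ->
  congC (p v * psi_coef alpha m0 m1)
    (psi_coef alpha (v ++ m0) m1 + psi_coef alpha m0 (v ++ m1)).
Proof.
move=> vn; rewrite /psi_coef -catA.
exact: (congr_scaled _ Iring (psum_reduce m0 m1 vn)).
Qed.

Lemma psi_coef_perm v v' w w' : perm_eq v v' -> perm_eq w w' ->
  congC (psi_coef alpha v w) (psi_coef alpha v' w').
Proof.
move=> vv' ww'; apply: (congrMl Iring); apply: (congrD Iring).
  by apply: (congrM Iring); apply: psum_perm.
by apply: (congrN Iring); apply: psum_perm; apply: perm_cat.
Qed.

Lemma psi_coefC v w : congC (psi_coef alpha v w) (psi_coef alpha w v).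
Proof.
apply: (congrMl Iring); apply: (congrD Iring).
  by rewrite mulrC; apply: (congr_refl Iring).
by apply: (congrN Iring); apply: psum_perm; rewrite perm_catC.
Qed.

Lemma psi_perm k k' : perm_eq k k' -> congI (psi k) (psi k').
Proof.
move=> kk'; rewrite /psi.
apply: (@tcongr_trans _ _ idealI (psi_coef alpha (part 0 k) (part 1 k) *: word_mono F (part 2 k'))).
  by apply: (tcongrZ idealI); apply: (word_perm idealI If1); apply: part_perm.
by apply: (tcongrZl idealI); apply: psi_coef_perm; apply: part_perm.
Qed.

Lemma psi_swap k : congI (psi (swap k)) (psi k).
Proof.
have e2 : tperm 0 1 (2 : 'I_3) = 2 by rewrite tpermD.
rewrite /psi !part_swap tpermL tpermR e2.
by apply: (tcongrZl idealI); apply: psi_coefC.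
Qed.

(** Multiplying by [v(a) + v(b)] paints the letters of [v] with either of the
    first two colors. *)
Lemma psi_paint v k : v != [::] ->
  congI (p v *: psi k) (psi (paint 0 v ++ k) + psi (paint 1 v ++ k)).
Proof.
move=> vn; rewrite /psi scalerA !part_cat !part_paint /= -scalerDl.
by apply: (tcongrZl idealI); apply: psi_coef_reduce.
Qed.

(** Absorb the traces one by one by [psi_paint]; the power of [alpha] comes from
    [Tr(v) = alpha p(v)]. *)
Lemma trace_mono_colorings vs w : [::] \notin vs ->
  congI (trace_mono F vs w)
      (fscale (alpha ^+ size vs) (\sum_(k <- colorings vs w) psi k)).
Proof.
elim: vs => [|v vs IH] /=.
  move=> _; rewrite /trace_mono big_nil mul1r big_seq1 /psi !part_paint /=.
  have -> : psi_coef alpha [::] [::] = 1.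
    rewrite /psi_coef /= (_ : 2 * 2 - 2 = 2%:A :> tcoef F).
      by rewrite -[X in X * _]/(in_alg _ _) -[X in _ * X]/(in_alg _ _) -rmorphM mulVf ?rmorph1.
    by rewrite -[RHS]/(in_alg _ _) rmorph_nat; ring.
  by rewrite /fscale !scale1r; apply: tcongr_refl.
rewrite inE negb_or eq_sym => /andP[vn /IH {}IH].
rewrite /trace_mono big_cons -mulrA -/(trace_mono F vs w) TrE mul_malgC.
rewrite (psum_tr vn) big_cat !big_map.
set S := \sum_(k <- colorings vs w) psi k in IH.
apply: (@tcongr_trans _ _ idealI ((alpha%:A * p v) *: fscale (alpha ^+ size vs) S)).
  exact: (tcongrZ idealI).
have -> : (alpha%:A * p v) *: fscale (alpha ^+ size vs) S =
          fscale (alpha ^+ (size vs).+1) (p v *: S).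
  by rewrite /fscale exprS (scal_algM alpha (alpha ^+ size vs)); apply: scaler_swap.
apply: (tcongrZ idealI); rewrite /S scaler_sumr -[X in tcongr _ _ X]big_split.
by apply: (tcongr_sum idealI) => k; apply: psi_paint.
Qed.

End NormalForm.

(** * Normal form of a trace polynomial *)

Section Expansion.
Variable F : fieldType.

Lemma cmonom_tr_words (m : {cmonom cyc_word}) : exists2 vs : seq (seq nat),
  [::] \notin vs & << m >> = \prod_(v <- vs) tr_word F v.
Proof.
have [n] := ubnP (mdeg m); elim: n => // n IH in m *; rewrite ltnS => mn.
have [->|m1] := eqVneq m mone; first by exists [::]; rewrite ?big_nil.
have /fset0Pn[c cm] : finsupp m != fset0.
  apply: contraNneq m1 => m0; rewrite -mdeg_eq0 mdegE m0 big_seq_fset0 //.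
pose m' := divcm m (ucm c).
have mE : m = mmul (ucm c) m'.
  apply/eqP/cmP => i; rewrite cmM divcmE cmU subnKC //.
  by case: eqP => // <-; rewrite lt0n cmE_neq0.
have [|vs vsn vsE] := IH m'.
  by apply: leq_trans mn; rewrite mE mdegM mdegU.
exists (val (repr c) :: vs).
  by rewrite inE negb_or vsn eq_sym (valP (repr c)).
rewrite big_cons tr_word_val reprK -vsE {1}mE.
by rewrite -[RHS]/(fgmul _ _) fgmulUU mulr1.
Qed.

Lemma trace_monoE vs w :
  trace_mono F vs w = (\prod_(v <- vs) tr_word F v) *: word_mono F w.
Proof.
rewrite /trace_mono -mul_malgC; congr (_ * _); rewrite rmorph_prod.
by apply: eq_bigr => v _; rewrite TrE.
Qed.

(** Trace monomials span the trace polynomials over the base field. *)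
Lemma tpoly_ind (P : tpoly F -> Prop) :
  P 0 -> (forall f g, P f -> P g -> P (f + g)) ->
  (forall a f, P f -> P (fscale a f)) ->
  (forall vs w, [::] \notin vs -> P (trace_mono F vs w)) ->
  forall f, P f.
Proof.
move=> P0 PD PZ Pm f; rewrite [f]tpoly_sum; apply: big_ind => // m _.
rewrite [f@_m]monalgE scaler_suml; apply: big_ind => // k _.
have [vs vsn vsE] := cmonom_tr_words k.
have := PZ (f@_m)@_k _ (Pm vs m vsn).
rewrite trace_monoE -vsE /fscale scalerA.
have -> : ((f@_m)@_k)%:A * << k >> = << (f@_m)@_k *g k >> :> tcoef F.
  by rewrite -scalerAl mul1r malg_scaleU.
by [].
Qed.

Variable alpha : F.
Hypothesis alpha0 : alpha != 0.
Hypothesis two_neq0 : 2 != 0 :> F.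

Lemma fscaleD a b (f : tpoly F) : fscale (a + b) f = fscale a f + fscale b f.
Proof.
have e : (a + b)%:A = a%:A + b%:A :> tcoef F := rmorphD (in_alg (tcoef F)) a b.
by rewrite /fscale e; exact: scalerDl.
Qed.

Lemma fscaleDr a (f g : tpoly F) : fscale a (f + g) = fscale a f + fscale a g.
Proof. exact: scalerDr. Qed.

Lemma fscale_sumr a (J : Type) (r : seq J) (f : J -> tpoly F) :
  fscale a (\sum_(j <- r) f j) = \sum_(j <- r) fscale a (f j).
Proof. exact: scaler_sumr. Qed.

Lemma fscaleA a b (f : tpoly F) : fscale a (fscale b f) = fscale (a * b) f.
Proof. by rewrite /fscale (scal_algM a b); exact: scalerA. Qed.

(** The combination does not depend on the ideal: this allows it to be compared
    with [f] both modulo the identities and modulo the ideal generated by [f_1]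
    and [g_3]. *)
Lemma normal_form (f : tpoly F) : exists r : seq (F * colored_word),
  forall I, trace_T_ideal I -> I (poly_f1 F) -> I (poly_g3 alpha) ->
  tcongr I f (\sum_(x <- r) fscale x.1 (psi alpha x.2)).
Proof.
elim/tpoly_ind: f => [|f g [r rP] [s sP]|a f [r rP]|vs w vsn].
- by exists [::] => I idealI _ _; rewrite big_nil; apply: (tcongr_refl idealI).
- exists (r ++ s) => I idealI If1 Ig3; rewrite big_cat.
  exact: (tcongrD idealI (rP I idealI If1 Ig3) (sP I idealI If1 Ig3)).
- pose S := \sum_(x <- r) fscale x.1 (psi alpha x.2).
  have sE : \sum_(x <- [seq (a * y.1, y.2) | y <- r]) fscale x.1 (psi alpha x.2) =
            fscale a S.
    by rewrite /S big_map fscale_sumr; apply: eq_bigr => x _; exact/esym/fscaleA.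
  exists [seq (a * x.1, x.2) | x <- r] => I idealI If1 Ig3; rewrite sE.
  exact: (tcongrZ idealI a%:A (rP I idealI If1 Ig3)).
- exists [seq (alpha ^+ size vs, k) | k <- colorings vs w] => I idealI If1 Ig3.
  rewrite big_map -fscale_sumr; exact: (trace_mono_colorings alpha0 two_neq0 idealI If1 Ig3 w vsn).
Qed.

End Expansion.

(** * Evaluation at diagonal matrices *)

Section DiagonalEvaluation.
Variables (F : fieldType) (alpha : F).
Hypothesis alpha0 : alpha != 0.
Hypothesis two_neq0 : 2 != 0 :> F.

Definition entry (c : 'I_3) (M : diag3 F) : F := diag3_mx M c c.

Lemma entryM c (M N : diag3 F) : entry c (M * N) = entry c M * entry c N.
Proof.
rewrite /entry -[diag3_mx (M * N)]/(val (M * N)) rmorphM /=.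
case: M N => [M /= HM] [N /= HN].
have /diag_mxP[d ->] : is_diag_mx M by [].
have /diag_mxP[e ->] : is_diag_mx N by [].
by rewrite -[_ * _ in LHS]/(_ *m _) mulmx_diag !mxE eqxx !mulr1n.
Qed.

Lemma entryD c (M N : diag3 F) : entry c (M + N) = entry c M + entry c N.
Proof. by rewrite /entry -[diag3_mx _]/(val _) raddfD mxE. Qed.

Lemma entryZ c a (M : diag3 F) : entry c (a *: M) = a * entry c M.
Proof. by rewrite /entry -[diag3_mx _]/(val _) linearZ mxE. Qed.

Lemma entry1 c : entry c 1 = 1.
Proof. by rewrite /entry -[diag3_mx _]/(val _) rmorph1 mxE eqxx. Qed.

Lemma entry0 c : entry c 0 = 0.
Proof. by rewrite /entry -[diag3_mx _]/(val _) raddf0 mxE. Qed.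

Variable u : nat * 'I_3 -> F.

Definition diag_point (i : nat) : diag3 F :=
  @Diag3 F (diag_mx (\row_j u (i, j))) (diag_mx_is_diag _).

Definition cprod (c : 'I_3) (v : seq nat) : F := \prod_(i <- v) u (i, c).

Definition chi (k : colored_word) : F := \prod_(x <- k) u x.

Lemma cprod_cat c v w : cprod c (v ++ w) = cprod c v * cprod c w.
Proof. exact: big_cat. Qed.

Lemma entry_word c v : entry c (word_prod diag_point v) = cprod c v.
Proof.
elim: v => [|i v IH]; first by rewrite /word_prod /cprod !big_nil entry1.
rewrite /word_prod /cprod !big_cons entryM -/(word_prod _ v) IH.
by rewrite /entry /= !mxE eqxx.
Qed.

Lemma chiE k : chi k =
  cprod 0 (part 0 k) * cprod 1 (part 1 k) * cprod 2 (part 2 k).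
Proof.
rewrite /cprod /part !big_map !big_filter.
elim: k => [|[i c] k IH]; first by rewrite /chi !big_nil !mulr1.
rewrite /chi !big_cons -/(chi k) IH /=.
case: c => [[|[|[|c]]] ltc] //=.
- have -> : Ordinal ltc = 0 by apply: val_inj.
  by rewrite /= !mulrA.
- have -> : Ordinal ltc = 1 by apply: val_inj.
  by rewrite /=; ring.
- have -> : Ordinal ltc = 2 by apply: val_inj.
  by rewrite /=; ring.
Qed.

Local Notation t := (diag3_tr alpha).
Local Notation evc := (eval_coef idfun t diag_point).
Local Notation ev := (eval_tpoly idfun t diag_point).

Lemma eval_tr_word v : v != [::] ->
  evc (tr_word F v) = alpha * (cprod 0 v + cprod 1 v).
Proof.
move=> vn; rewrite (eval_coef_tr_word _ (t := t) (trace_word_rot t diag_point) vn).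
by rewrite -!entry_word mulrDr.
Qed.

Lemma eval_psum v : evc (psum alpha v) = cprod 0 v + cprod 1 v.
Proof.
pose f := GRing.RMorphism.clone _ _ evc _.
have fE x : evc x = f x by [].
case: v => [|i v]; first by rewrite fE rmorph_nat /cprod !big_nil.
rewrite /psum fE rmorphM -!fE eval_tr_word // (eval_coef_alg idfun t) /=.
by rewrite mulKf.
Qed.

Lemma eval_psi_coef v w : evc (psi_coef alpha v w) =
  2^-1 * (cprod 0 v * cprod 1 w + cprod 1 v * cprod 0 w).
Proof.
pose f := GRing.RMorphism.clone _ _ evc _.
have fE x : evc x = f x by [].
rewrite /psi_coef fE rmorphM rmorphB rmorphM -!fE !eval_psum !cprod_cat.
rewrite (eval_coef_alg idfun t) /=.
by congr (_ * _); ring.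
Qed.

(** The third entry is enough: it shows the coefficients, which depend on the
    first two entries of the point only, next to the letters painted [2]. *)
Lemma eval_psi k :
  entry 2 (ev (psi alpha k)) = 2^-1 * (chi k + chi (swap k)).
Proof.
have e2 : tperm 0 1 (2 : 'I_3) = 2 by rewrite tpermD.
rewrite !chiE !part_swap tpermL tpermR e2.
rewrite /psi (eval_tpolyZ idfun t) (eval_tpoly_word idfun t) entryZ entry_word.
by rewrite eval_psi_coef; ring.
Qed.

End DiagonalEvaluation.

Section DiagonalIdentities.
Variables (F : fieldType) (alpha : F).
Hypothesis alpha0 : alpha != 0.
Hypothesis charF0 : [pchar F] =i pred0.
Local Notation t := (diag3_tr alpha).

Lemma two_neq0 : 2 != 0 :> F.
Proof. by rewrite ((pcharf0P F).1 charF0). Qed.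

Lemma f1_identity : trace_identity t (poly_f1 F).
Proof.
move=> u; have eM i j := eval_tpolyM t u (tvar F i) (tvar F j).
have e : eval_tpoly idfun t u (tvar F 0 * tvar F 1) =
         eval_tpoly idfun t u (tvar F 1 * tvar F 0).
  exact: etrans (eM 0 1)%N (etrans (diag3_mulC _ _) (esym (eM 1 0)%N)).
have eB := raddfB (GRing.Additive.clone _ _ (eval_tpoly idfun t u) _)
  (tvar F 0 * tvar F 1) (tvar F 1 * tvar F 0).
by apply: (etrans eB); apply/eqP; rewrite subr_eq0; apply/eqP.
Qed.

Lemma g3_identity : trace_identity t (poly_g3 alpha).
Proof.
move=> u; rewrite poly_g3E (eval_tpolyC idfun t).
pose f := GRing.RMorphism.clone _ _ (eval_coef idfun t u) _.
have evT v : v != [::] -> f (tr_word F v) = t (word_prod u v).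
  by move=> vn; rewrite -(eval_coef_tr_word idfun (t := t) (trace_word_rot t u) vn).
have evA a : f a%:A = a by exact: (eval_coef_alg idfun t).
have := @rmorph_g3_form _ _ f _ _ _ _ _ _ _ _ _ _ _ _ _ _ _ _ _ _
  (evA (2 * alpha ^+ 2)) (evA alpha) (evT [:: 0]%N isT) (evT [:: 1]%N isT)
  (evT [:: 2]%N isT) (evT [:: 0; 1]%N isT) (evT [:: 0; 2]%N isT)
  (evT [:: 1; 2]%N isT) (evT [:: 0; 1; 2]%N isT).
rewrite -[X in X = _]/(eval_coef idfun t u (g3_coef alpha)) => ->.
rewrite /word_prod !big_cons !big_nil /=.
have trE M : diag3_tr_fun alpha M = alpha * entry 0 M + alpha * entry 1 M by [].
rewrite /g3_form !trE !entryM !entry1.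
move: (entry 0 _) (entry 0 _) (entry 0 _) (entry 1 _) (entry 1 _) (entry 1 _).
move=> a0 a1 a2 b0 b1 b2; set e := (X in X *: _).
have -> : e = 0 by rewrite /e; ring.
by rewrite scale0r.
Qed.

End DiagonalIdentities.

(** * The ideal of identities is generated by f_1 and g_3 *)

Section TraceIdeal.
Variables (F : fieldType) (alpha : F).
Hypothesis alpha0 : alpha != 0.
Hypothesis charF0 : [pchar F] =i pred0.
Local Notation t := (diag3_tr alpha).
Local Notation psi := (psi alpha).
Let two0 : 2 != 0 :> F := two_neq0 charF0.

Lemma eval_psi_sum (u : nat * 'I_3 -> F) (r : seq (F * colored_word)) :
  entry 2 (eval_tpoly idfun t (diag_point u)
    (\sum_(x <- r) fscale x.1 (psi x.2))) =
  \sum_(x <- r) x.1 * (2^-1 * (chi u x.2 + chi u (swap x.2))).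
Proof.
rewrite raddf_sum (big_morph _ (entryD 2) (entry0 F 2)).
apply: eq_bigr => x _ /=; rewrite /fscale (eval_tpolyZ idfun t).
by rewrite (eval_coef_alg idfun t) entryZ eval_psi.
Qed.

(** A combination of [psi]'s that is an identity gives, by [eval_psi], a vanishing
    combination of the monomials [k] and [swap k]. *)
Lemma psi_free (r : seq (F * colored_word)) (V : zmodType) (g : F -> colored_word -> V) :
  (forall b c k, g (b + c) k = g b k + g c k) ->
  (forall b k1 k2, perm_eq k1 k2 -> g b k1 = g b k2) ->
  trace_identity t (\sum_(x <- r) fscale x.1 (psi x.2)) ->
  \sum_(x <- r) (g x.1 x.2 + g x.1 (swap x.2)) = 0.
Proof.
move=> gD gperm idr.
pose s := r ++ [seq (x.1, swap x.2) | x <- r].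
rewrite big_split /= -(big_map (fun x => (x.1, swap x.2)) xpredT (fun x => g x.1 x.2)).
rewrite -big_cat; apply: (@monomials_free_sum _ _ charF0 _ s fst snd V g gD gperm).
move=> u; have := eval_psi_sum u r; rewrite idr entry0.
rewrite /s big_cat big_map /= -big_split /= => /esym/eqP.
under eq_bigr => x _ do rewrite mulrCA mulrDr.
by rewrite -mulr_sumr mulf_eq0 invr_eq0 (negbTE two0) => /eqP.
Qed.

(** A representative of the commutative monomial of [k], used to make [psi]
    strictly insensitive to the order of letters and not only modulo an ideal. *)
Definition canon (k : colored_word) : colored_word := choose (perm_eq k) k.

Lemma perm_canon k : perm_eq k (canon k).
Proof. exact: (chooseP (perm_refl k)). Qed.

Lemma eq_canon k k' : perm_eq k k' -> canon k = canon k'.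
Proof.
move=> kk'; rewrite /canon (@eq_choose _ (perm_eq k) (perm_eq k')); last first.
  by move=> x; apply: permPl.
by apply: choose_id => //; rewrite perm_sym.
Qed.

Lemma identity_psi_sum (r : seq (F * colored_word)) (I : tpoly F -> Prop) :
  trace_T_ideal I -> I (poly_f1 F) -> I (poly_g3 alpha) ->
  trace_identity t (\sum_(x <- r) fscale x.1 (psi x.2)) ->
  I (\sum_(x <- r) fscale x.1 (psi x.2)).
Proof.
move=> idealI If1 Ig3 idr; set S := \sum_(x <- r) _.
pose g a k := fscale a (psi (canon k)).
have gD b c k : g (b + c) k = g b k + g c k by apply: fscaleD.
have gperm b k1 k2 : perm_eq k1 k2 -> g b k1 = g b k2.
  by move=> k12; rewrite /g (eq_canon k12).
have S0 := psi_free gD gperm idr.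
have canonI k : tcongr I (psi k) (psi (canon k)).
  exact: (psi_perm alpha idealI If1 (perm_canon k)).
(* psi_free makes the sum of the canonical psi's of k and of swap k vanish, and
   both are congruent to psi k: this gives twice the sum to be treated. *)
have S2 : tcongr I (S + S) 0.
  rewrite -S0 /S -[X in tcongr I X _]big_split.
  apply: (tcongr_sum idealI) => x; apply: (tcongrD idealI); apply: (tcongrZ idealI).
    exact: canonI.
  apply: (tcongr_trans idealI (tcongr_sym idealI (psi_swap alpha idealI If1 x.2))).
  exact: canonI.
have S2' : S = fscale 2^-1 (S + S).
  have half2 : 2^-1 + 2^-1 = 1 :> F by rewrite -mulr2n -(mulr_natr 2^-1 2) mulVf.
  rewrite (fscaleDr 2^-1 S S) -(fscaleD 2^-1 2^-1 S) half2 /fscale.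
  by rewrite !scale1r.
rewrite S2'; apply: (idealZ idealI).
apply: (tcongr_ideal idealI S2); exact: (tideal0 idealI).
Qed.

Lemma identity_gen (f : tpoly F) : trace_identity t f <->
  trace_T_ideal_gen (fun g => g = poly_f1 F \/ g = poly_g3 alpha) f.
Proof.
have idealT := trace_identity_ideal t.
have Tf1 := f1_identity alpha; have Tg3 := g3_identity alpha.
split=> [idf I idealI Igen | genf]; last first.
  by apply: genf => // g [] ->.
have [r rP] := normal_form alpha0 two0 f.
have If1 := Igen _ (or_introl erefl); have Ig3 := Igen _ (or_intror erefl).
apply: (tcongr_ideal idealI (rP I idealI If1 Ig3)).
apply: identity_psi_sum => //.
exact: (tcongr_ideal idealT (tcongr_sym idealT (rP _ idealT Tf1 Tg3)) idf).
Qed.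

End TraceIdeal.

(** * The value of the codimension *)

Section Counting.
Local Open Scope nat_scope.

(** A partition into two blocks is [{A, ~A}] for exactly two sets [A], and these
    are neither empty nor full. For [t = 0] the empty set is the full one, whence
    the correction. *)
Lemma stirling2_2 t : (stirling2 t 2).*2 + 2 = 2 ^ t + (t == 0).
Proof.
pose Q := [set P : {set {set 'I_t}} | partition P [set: 'I_t] & #|P| == 2].
pose proper := [set A : {set 'I_t} | (A != set0) && (A != setT)].
have proper_card : #|proper| + 2 = 2 ^ t + (t == 0).
  have -> : proper = setT :\: [set set0; setT] by apply/setP => A; rewrite !inE negb_or andbT.
  have -> : 2 ^ t = #|[set: {set 'I_t}]|.
    by rewrite -powersetT card_powerset cardsT card_ord.
  rewrite -(cardsID [set set0; setT] setT) setTI cards2 addnAC addnC.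
  congr (_ + _); rewrite addnC [RHS]addnC.
  case: t {Q proper} => [|t].
    by have -> : set0 = setT :> {set 'I_0} by [apply/setP => -[]]; rewrite eqxx.
  suff -> : set0 != setT :> {set 'I_t.+1} by [].
  by apply/eqP => /setP /(_ ord0); rewrite !inE.
rewrite -proper_card -/Q; congr (_ + 2).
pose f (A : {set 'I_t}) := [set A; ~: A].
have fQ A : A \in proper -> f A \in Q.
  rewrite !inE => /andP[A0 AT].
  have AC : A != ~: A.
    apply: contraNneq A0 => AC; apply/eqP/setP => x; rewrite inE.
    by have /setP/(_ x) := AC; rewrite inE; case: (x \in A).
  rewrite cards2 AC eqxx andbT; apply/and3P; split.
  - by rewrite /cover /f big_setU1 ?inE //= big_set1 setUCr.
  - apply/trivIsetP => B C; rewrite !inE => /orP[] /eqP -> /orP[] /eqP ->;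
      rewrite ?eqxx // => _; rewrite -setI_eq0 ?setICr ?eqxx // setIC setICr eqxx //.
  - rewrite !inE negb_or eq_sym A0 eq_sym /=.
    by apply: contraNneq AT => AC0; rewrite -[A]setCK AC0 setC0.
have QE P A : P \in Q -> (A \in P) = (A \in proper) && (f A == P).
  move=> PQ; apply/idP/andP => [AP|[_ /eqP <-]]; last by rewrite !inE eqxx.
  move: PQ; rewrite inE => /andP[/and3P[/eqP covP trivP P0] /eqP cP].
  have [B PE] : exists B, P :\ A = [set B].
    by apply/cards1P; have := cardsD1 A P; rewrite AP cP add1n => -[<-].
  have BA : B != A by have /setP/(_ B) := PE; rewrite !inE eqxx => /andP[].
  have {}PE : P = [set A; B] by rewrite -(setD1K AP) PE.
  have BP : B \in P by rewrite PE !inE eqxx orbT.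
  have AUB x : (x \in A) || (x \in B).
    have /bigcupP[C] : x \in cover P by rewrite covP in_setT.
    by rewrite PE !inE => /orP[] /eqP -> ->; rewrite ?orbT.
  have disjAB : [disjoint A & B] by apply: (trivIsetP trivP) => //; rewrite eq_sym.
  have BE : B = ~: A.
    apply/setP => x; rewrite inE; have := AUB x.
    by case xA: (x \in A) => //=; rewrite (disjointFr disjAB xA).
  rewrite PE /f -BE eqxx inE; split=> //; apply/andP; split.
    by apply: contraNneq P0 => <-.
  by apply: contraNneq P0 => AT; rewrite -setCT -AT -BE.
have -> : #|proper| = \sum_(P in Q) #|P|.
  rewrite -sum1_card (partition_big f (mem Q)) //; apply: eq_bigr => P PQ.
  by rewrite -sum1_card; apply: eq_bigl => A; rewrite (QE _ _ PQ).
rewrite (eq_bigr (fun=> 2)) => [|P]; last by rewrite inE => /andP[_ /eqP].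
by rewrite sum_nat_const muln2.
Qed.

(** Doubling the sum and adding [2 * 2^n] to its second part turns
    [2 S(t, 2) + 2] into [2^t], up to the term [t = 0]; the binomial theorem
    concludes. *)
Lemma codim_formula n :
  (\sum_(0 <= k < n.+1) 'C(n, k) +
   \sum_(2 <= t < n.+1) 'C(n, t) * stirling2 t 2).*2 = 3 ^ n + 1.
Proof.
have bin2 : \sum_(0 <= k < n.+1) 'C(n, k) = 2 ^ n.
  rewrite -[2]/(1 + 1) expnDn big_mkord; apply: eq_bigr => i _.
  by rewrite !exp1n !muln1.
have bin3 : \sum_(0 <= t < n.+1) 'C(n, t) * 2 ^ t = 3 ^ n.
  rewrite -[3]/(1 + 2) expnDn big_mkord; apply: eq_bigr => i _.
  by rewrite exp1n mul1n.
have S2 t : t < 2 -> stirling2 t 2 = 0.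
  move=> t2; apply/eqP; rewrite -double_eq0 -(eqn_add2r 2) stirling2_2.
  by case: t t2 => [|[|]].
have -> : \sum_(2 <= t < n.+1) 'C(n, t) * stirling2 t 2 =
          \sum_(0 <= t < n.+1) 'C(n, t) * stirling2 t 2.
  case: n {bin2 bin3} => [|n].
    by rewrite big_geq // big_nat1 S2.
  have z : \sum_(0 <= t < 2) 'C(n.+1, t) * stirling2 t 2 = 0.
    by rewrite big_nat; apply: big1 => t /andP[_ t2]; rewrite S2 // muln0.
  rewrite [RHS](@big_cat_nat _ _ _ 2) //.
  exact: esym (congr1 (addn^~ _) z).
have : \sum_(0 <= t < n.+1) 'C(n, t) * ((stirling2 t 2).*2 + 2) =
       \sum_(0 <= t < n.+1) 'C(n, t) * (2 ^ t + (t == 0)).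
  by apply: eq_bigr => t _; rewrite stirling2_2.
under eq_bigr => t _ do rewrite mulnDr -muln2 mulnA.
under [RHS]eq_bigr => t _ do rewrite mulnDr.
rewrite !big_split /= -!big_distrl /= bin3 bin2.
have -> : \sum_(0 <= t < n.+1) 'C(n, t) * (t == 0) = 1.
  by rewrite big_nat_recl // bin0 big1_seq ?addn0 // => i _; rewrite muln0.
by move=> <-; rewrite doubleD -!muln2 addnC.
Qed.

End Counting.

Lemma scale_sub_expand (R : comNzRingType) (V : lmodType R) (h a b c : R) (x : V) :
  (h * (a * b - c)) *: x = h *: ((a * (b * 1)) *: x + (-1) *: ((c * 1) *: x)).
Proof. by rewrite !mulr1 scaleN1r -scalerBl scalerA. Qed.

(** * A basis of the multilinear part modulo the identities *)

Section Codimension.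
Variables (F : fieldType) (alpha : F) (n : nat).
Hypothesis alpha0 : alpha != 0.
Hypothesis charF0 : [pchar F] =i pred0.
Local Notation t := (diag3_tr alpha).
Local Notation psi := (psi alpha).
Let two0 : 2 != 0 :> F := two_neq0 charF0.

Let coloring := {ffun 'I_n -> 'I_3}.

Definition coloring_word (g : coloring) : colored_word := [seq (val i, g i) | i <- enum 'I_n].
Definition swap_coloring (g : coloring) : coloring := [ffun i => tperm 0 1 (g i)].
(** One coloring in each orbit of the exchange of the first two colors, the
    smaller one for the enumeration of colorings. *)
Definition reps : {set coloring} := [set g | enum_rank g <= enum_rank (swap_coloring g)]%N.

Lemma swap_coloringK : involutive swap_coloring.
Proof. by move=> g; apply/ffunP => i; rewrite !ffunE tpermK. Qed.

Lemma swap_coloring_word g : swap (coloring_word g) = coloring_word (swap_coloring g).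
Proof. by rewrite /swap /coloring_word -map_comp; apply: eq_map => i /=; rewrite ffunE. Qed.

Lemma coloring_word_uniq g : uniq (coloring_word g).
Proof. by rewrite map_inj_uniq ?enum_uniq // => i j [/val_inj]. Qed.

Lemma mem_coloring_word g i c : ((val i, c) \in coloring_word g) = (c == g i).
Proof.
apply/mapP/eqP => [[j _ [/val_inj <- ->]] //|->].
by exists i; rewrite ?mem_enum.
Qed.

Lemma perm_coloring_word g h : perm_eq (coloring_word g) (coloring_word h) -> g = h.
Proof.
move=> /perm_mem gh; apply/ffunP => i; apply/eqP.
by rewrite -mem_coloring_word -gh mem_coloring_word.
Qed.

Lemma unzip1_coloring_word g : unzip1 (coloring_word g) = iota 0 n.
Proof. by rewrite /unzip1 /coloring_word -map_comp -val_enum_ord; apply: eq_map. Qed.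

(** Up to the order of its letters, a colored word in which each of [0, ..., n-1]
    occurs once is the graph of a coloring. *)
Lemma coloring_of_word (k : colored_word) : perm_eq (unzip1 k) (iota 0 n) ->
  exists g, perm_eq k (coloring_word g).
Proof.
move=> kn; pose x0 : nat * 'I_3 := (0%N, 0).
pose g : coloring := [ffun i : 'I_n => (nth x0 k (index (val i) (unzip1 k))).2].
exists g; have sz : size k = n by rewrite -(size_iota 0 n) -(perm_size kn) size_map.
have sub : {subset coloring_word g <= k}.
  move=> _ /mapP[i _ ->].
  have ik : val i \in unzip1 k by rewrite (perm_mem kn) mem_iota ltn_ord.
  have lt : (index (val i) (unzip1 k) < size k)%N by rewrite -(size_map fst) index_mem.
  suff -> : (val i, g i) = nth x0 k (index (val i) (unzip1 k)) by apply: mem_nth.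
  rewrite ffunE [RHS]surjective_pairing; congr (_, _).
  by rewrite -(nth_map x0 0%N) // nth_index.
have ku : uniq k by apply: (@map_uniq _ _ fst); rewrite (perm_uniq kn) iota_uniq.
rewrite perm_sym uniq_perm ?coloring_word_uniq //.
have le_sz : (size k <= size (coloring_word g))%N by rewrite sz size_map size_enum_ord.
by have [_ gk] := uniq_min_size (coloring_word_uniq g) sub le_sz.
Qed.

(** [reps] and its image under the exchange cover all colorings, and they meet in
    the fixed points, of which there is one. *)
Lemma card_reps : (#|reps|.*2 = 3 ^ n + 1)%N.
Proof.
have sw_reps : swap_coloring @: reps = [set g | enum_rank (swap_coloring g) <= enum_rank g]%N.
  apply/setP => g; rewrite inE -{1}[g]swap_coloringK (mem_imset _ _ (can_inj swap_coloringK)) inE.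
  by rewrite swap_coloringK.
have repsU : reps :|: swap_coloring @: reps = setT.
  by apply/setP => g; rewrite sw_reps !inE leq_total.
have repsI : reps :&: swap_coloring @: reps = [set [ffun=> 2]].
  apply/setP => g; rewrite sw_reps !inE -eqn_leq val_eqE.
  rewrite (inj_eq enum_rank_inj) eq_sym; apply/eqP/eqP => [/ffunP gE|->].
    apply/ffunP => i; have := gE i; rewrite !ffunE; case: tpermP => //.
    - by move=> ->.
    - by move=> ->.
    case: (g i) => [[|[|[|]]] lt] // n0 n1 _; last exact: val_inj.
      by case: n0; apply: val_inj.
    by case: n1; apply: val_inj.
  by apply/ffunP => i; rewrite !ffunE tpermD.
rewrite -addnn -{2}(card_imset _ (can_inj swap_coloringK)) -cardsUI repsU repsI cards1.
by rewrite cardsT card_ffun !card_ord.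
Qed.

Lemma reps_swap g h : g \in reps -> h \in reps -> swap_coloring h = g -> h = g.
Proof.
rewrite !inE => gr hr hg; rewrite hg in hr; rewrite -hg swap_coloringK hg in gr.
by apply/enum_rank_inj/val_inj/eqP; rewrite /= eqn_leq hr gr.
Qed.

Definition basis (i : 'I_#|reps|) : tpoly F := psi (coloring_word (enum_val i)).

Lemma part_perm_eq (k : colored_word) :
  perm_eq (part 0 k ++ part 1 k ++ part 2 k) (unzip1 k).
Proof.
apply/seq.permP => a; rewrite !count_cat /part !count_map !count_filter.
elim: k => //= -[i c] k /= <-.
have c3 : [|| c == 0, c == 1 | c == 2] by case: c => [[|[|[|c]]] ltc].
case/or3P: c3 => /eqP ->; rewrite /= ?andbT ?andbF ?add0n; by ring.
Qed.

Lemma unzip1_colorings vs w k : k \in colorings vs w ->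
  unzip1 k = flatten vs ++ w.
Proof.
have up c v : unzip1 (paint c v) = v by rewrite /unzip1 /paint -map_comp map_id.
elim: vs k => [|v vs IH] k /=; first by rewrite inE => /eqP ->.
rewrite mem_cat => /orP[] /mapP[k' /IH k'E ->];
  by rewrite /unzip1 map_cat -!/(unzip1 _) up k'E catA.
Qed.

Lemma MTD (f g : tpoly F) : MT n f -> MT n g -> MT n (f + g).
Proof.
move=> [r [c [vs [w [mf ->]]]]] [s [d [vs' [w' [mg ->]]]]].
exists (r + s)%N.
exists (fun i => match split i with inl j => c j | inr j => d j end).
exists (fun i => match split i with inl j => vs j | inr j => vs' j end).
exists (fun i => match split i with inl j => w j | inr j => w' j end).
split; first by move=> i; case: (split i).
rewrite [RHS]big_split_ord.
apply: (congr2 +%R).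
  apply: eq_bigr => i _.
  by rewrite -[lshift s i]/(unsplit (inl i)) (unsplitK (inl i)).
apply: eq_bigr => i _.
by rewrite -[rshift r i]/(unsplit (inr i)) (unsplitK (inr i)).
Qed.

Lemma MTZ a (f : tpoly F) : MT n f -> MT n (fscale a f).
Proof.
move=> [r [c [vs [w [mf ->]]]]]; exists r, (fun i => a * c i), vs, w; split=> //.
by rewrite fscale_sumr; apply: eq_bigr => i _; rewrite fscaleA.
Qed.

Lemma MT0 : MT n (0 : tpoly F).
Proof.
exists 0%N, (fun=> 0), (fun=> [::]), (fun=> [::]); split; first by case.
by rewrite big_ord0.
Qed.

Lemma MT_mono vs w : multilinear_mono n vs w -> MT n (trace_mono F vs w).
Proof.
exists 1%N, (fun=> 1), (fun=> vs), (fun=> w); split=> //.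
by rewrite big_ord1 /fscale !scale1r.
Qed.

Lemma MT_sum (J : Type) (r : seq J) (f : J -> tpoly F) :
  (forall j, MT n (f j)) -> MT n (\sum_(j <- r) f j).
Proof. by move=> Mf; apply: big_ind => //; [exact: MT0|exact: MTD]. Qed.

(** Products of normalized traces are trace monomials up to a scalar, the empty
    words contributing factors [2]. *)
Lemma psum_prod (vs : seq (seq nat)) : exists a : F,
  \prod_(v <- vs) psum alpha v =
  a%:A * \prod_(v <- [seq v <- vs | v != [::]]) tr_word F v.
Proof.
elim: vs => [|v vs [a aE]]; first by exists 1; rewrite !big_nil mulr1 scale1r.
have A2 : (2%:A : tcoef F) = 2 by exact: (rmorph_nat (in_alg (tcoef F)) 2).
rewrite big_cons aE /=; case: v => [|i v] /=.
  exists (2 * a); rewrite (scal_algM 2 a) A2; exact: mulrA.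
exists (alpha^-1 * a); rewrite big_cons (scal_algM alpha^-1 a).
exact: mulrACA.
Qed.

Lemma MT_psum vs w : perm_eq (flatten vs ++ w) (iota 0 n) ->
  MT n ((\prod_(v <- vs) psum alpha v) *: word_mono F w).
Proof.
move=> vw; have [a ->] := psum_prod vs.
have := @MTZ a (trace_mono F [seq v <- vs | v != [::]] w).
rewrite trace_monoE /fscale scalerA; apply.
rewrite -trace_monoE; apply: MT_mono; rewrite /multilinear_mono mem_filter eqxx /=.
suff -> : flatten [seq v <- vs | v != [::]] = flatten vs by [].
by elim: (vs) => //= -[|i v] vs' IH //=; rewrite IH.
Qed.

Lemma MT_psi k : perm_eq (unzip1 k) (iota 0 n) -> MT n (psi k).
Proof.
move=> kn; have pk := perm_trans (part_perm_eq k) kn.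
have M2 := @MT_psum [:: part 0 k; part 1 k] (part 2 k).
have M1 := @MT_psum [:: part 0 k ++ part 1 k] (part 2 k).
rewrite /= cats0 -catA in M2; rewrite /= cats0 -catA in M1.
move: M2 M1; rewrite !big_cons !big_nil => /(_ pk) M2 /(_ pk) M1.
have N1 : (-1)%:A = -1 :> tcoef F by exact: (rmorphN1 (in_alg (tcoef F))).
have := MTZ 2^-1 (MTD M2 (MTZ (-1) M1)); rewrite /fscale N1.
by rewrite -scale_sub_expand.
Qed.

Let idT := trace_identity_ideal t.
Let Tf1 := f1_identity alpha.
Let Tg3 := g3_identity alpha.
Local Notation "f =~ g" := (tcongr (trace_identity t) f g) (at level 70).

Definition spanned (f : tpoly F) := exists c : 'I_#|reps| -> F,
  f =~ \sum_i fscale (c i) (basis i).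

Lemma spannedD f g : spanned f -> spanned g -> spanned (f + g).
Proof.
move=> [c fc] [d gd]; exists (fun i => c i + d i).
have -> : \sum_i fscale (c i + d i) (basis i) =
   \sum_i fscale (c i) (basis i) + \sum_i fscale (d i) (basis i).
  by rewrite -[RHS]big_split; apply: eq_bigr => i _; apply: fscaleD.
exact: (tcongrD idT fc gd).
Qed.

Lemma spannedZ a f : spanned f -> spanned (fscale a f).
Proof.
move=> [c fc]; exists (fun i => a * c i).
have -> : \sum_i fscale (a * c i) (basis i) =
   fscale a (\sum_i fscale (c i) (basis i)).
  by rewrite fscale_sumr; apply: eq_bigr => i _; apply/esym/fscaleA.
exact: (tcongrZ idT _ fc).
Qed.

Lemma spanned_eq f g : f =~ g -> spanned g -> spanned f.
Proof. by move=> fg [c gc]; exists c; apply: (tcongr_trans idT fg gc). Qed.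

Lemma fscale0 (f : tpoly F) : fscale 0 f = 0.
Proof.
have e : 0%:A = 0 :> tcoef F by exact: (rmorph0 (in_alg (tcoef F))).
by rewrite /fscale e; exact: scale0r.
Qed.

Lemma spanned0 : spanned 0.
Proof.
exists (fun=> 0); rewrite big1 => [|i _]; first exact: (tcongr_refl idT).
exact: fscale0.
Qed.

Lemma spanned_sum (J : eqType) (r : seq J) (f : J -> tpoly F) :
  (forall j, j \in r -> spanned (f j)) -> spanned (\sum_(j <- r) f j).
Proof.
move=> sf; rewrite big_seq; apply: big_ind => //; first exact: spanned0.
exact: spannedD.
Qed.

Lemma spanned_basis i : spanned (basis i).
Proof.
exists (fun j => (i == j)%:R); rewrite (bigD1 i) //= eqxx big1 => [|j ji].
  by rewrite addr0 /fscale !scale1r; exact: (tcongr_refl idT).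
by rewrite eq_sym (negbTE ji); exact: fscale0.
Qed.

(** The order of letters and the exchange of the first two colors do not matter
    modulo the identities, so that a representative can be reached. *)
Lemma spanned_psi k : perm_eq (unzip1 k) (iota 0 n) -> spanned (psi k).
Proof.
move=> /coloring_of_word[g kg].
apply: (spanned_eq (psi_perm alpha idT Tf1 kg)).
have rep h : h \in reps -> spanned (psi (coloring_word h)).
  move=> hr; have := spanned_basis (enum_rank_in hr h).
  by rewrite /basis enum_rankK_in.
have [gr|gr] := boolP (g \in reps); first exact: rep.
apply: (spanned_eq (tcongr_sym idT (psi_swap alpha idT Tf1 (coloring_word g)))).
rewrite swap_coloring_word; apply: rep; move: gr; rewrite !inE swap_coloringK -ltnNge; exact: ltnW.
Qed.

Lemma MT_spanned f : MT n f -> spanned f.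
Proof.
move=> [r [c [vs [w [mvs ->]]]]]; apply: spanned_sum => i _.
apply: spannedZ; have /andP[vsn vsw] := mvs i.
apply: (spanned_eq (trace_mono_colorings alpha0 two0 idT Tf1 Tg3 (w i) vsn)).
apply: spannedZ; apply: spanned_sum => k /unzip1_colorings kE.
by apply: spanned_psi; rewrite kE.
Qed.

Lemma MT_basis i : MT n (basis i).
Proof. by apply: MT_psi; rewrite unzip1_coloring_word. Qed.

(** The coefficient of the monomial of the [i]-th representative in the value of
    the combination is [c i], or [2 c i] for the fixed coloring, because no other
    representative lies in the same orbit. *)
Lemma basis_free (c : 'I_#|reps| -> F) :
  trace_identity t (\sum_i fscale (c i) (basis i)) -> forall i, c i = 0.
Proof.
move=> idc i; pose r := [seq (c j, coloring_word (enum_val j)) | j <- enum 'I_#|reps|].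
pose g a (k : colored_word) : F := if perm_eq k (coloring_word (enum_val i)) then a else 0.
have gD a b k : g (a + b) k = g a k + g b k.
  by rewrite /g; case: ifP => // _; rewrite addr0.
have gperm a k1 k2 : perm_eq k1 k2 -> g a k1 = g a k2.
  by move=> k12; rewrite /g (permPl k12).
have idr : trace_identity t (\sum_(x <- r) fscale x.1 (psi x.2)).
  by rewrite /r big_map big_enum.
have := psi_free alpha0 charF0 gD gperm idr.
rewrite /r big_map big_enum /= (bigD1 i) //= big1 => [|j ji].
  rewrite /g perm_refl addr0; case: ifP => _; last by rewrite addr0.
  move=> /eqP; rewrite -mulr2n -(mulr_natr (c i) 2) mulf_eq0 (negbTE two0) orbF.
  by move=> /eqP.
rewrite /g; case: ifP => [/perm_coloring_word/enum_val_inj /eqP|_]; first by rewrite (negbTE ji).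
rewrite swap_coloring_word; case: ifP => [/perm_coloring_word e|_]; last by rewrite addr0.
have /enum_val_inj/eqP := reps_swap (enum_valP i) (enum_valP j) e.
by rewrite (negbTE ji).
Qed.

Lemma codim_reps : trace_codim t n #|reps|.
Proof.
exists basis; split=> [i|f fM|c [_ idc]]; first exact: MT_basis.
  have [c fc] := MT_spanned fM; exists c; split; last exact: fc.
  have MS : MT n (\sum_i fscale (c i) (basis i)).
    by apply: MT_sum => i; apply: MTZ; apply: MT_basis.
  have := MTD fM (MTZ (-1) MS).
  have N1 : (-1)%:A = -1 :> tcoef F by exact: (rmorphN1 (in_alg (tcoef F))).
  have -> : fscale (-1) (\sum_i fscale (c i) (basis i)) =
            - \sum_i fscale (c i) (basis i) by rewrite /fscale N1; exact: scaleN1r.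
  by [].
exact: basis_free.
Qed.

End Codimension.

Theorem theorem17 (F : fieldType) (charF0 : [pchar F] =i pred0)
    (alpha : F) (alpha_neq0 : alpha != 0) :
  (forall f : tpoly F,
     trace_identity (diag3_tr alpha) f <->
     trace_T_ideal_gen (fun g => g = poly_f1 F \/ g = poly_g3 alpha) f)
  /\
  (forall n : nat, (1 <= n)%N ->
     let c := (\sum_(0 <= k < n.+1) 'C(n, k) +
               \sum_(2 <= t < n.+1) 'C(n, t) * stirling2 t 2)%N in
     trace_codim (diag3_tr alpha) n c /\ c%:R = (3 ^+ n + 1) / 2 :> rat).
Proof.
split=> [f|n _ c]; first exact: identity_gen.
have cE : (c.*2 = 3 ^ n + 1)%N := codim_formula n.
have -> : c = #|reps n| by apply: double_inj; rewrite cE card_reps.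
split; first exact: codim_reps.
apply: (canRL (mulfK _)) => //.
by rewrite -natrM muln2 card_reps natrD natrX.
Qed.
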